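(* Consider, for each dimension $p$, the INO-PCA iterates driven by the spiked covariance data described in the context, with fixed parameters $\omega>0$, $\tau>0$. Assume that the law of $\mathbf{x}_0$ is exchangeable, that $\sup_p\langle x^4+\xi^4,\mu_0^p\rangle\le C$ for some finite constant $C$, that $\mu_0^p$ converges weakly to a deterministic $\mu_0\in\mathcal{M}(\mathbb{R}^2)$ as $p\to\infty$, that $\lambda_0=\Theta(1)$, and that the initial cosine similarity satisfies $Q_0\ne 0$. Let $(\mu_t)_{t\ge0}$ be the deterministic limit of $\mu^p_{\lfloor pt\rfloor}$ as $p\to\infty$, i.e. the unique solution of the weak-form PDE given in the context, and let $\lambda_t=\sqrt{\langle x^2,\mu_t\rangle}$ and $Q_t=\langle x\xi,\mu_t\rangle/\lambda_t$. Then the cosine similarity $Q_t$ satisfies the ODE $$\frac{d}{dt}Q_t=\frac{\tau Q_t}{\lambda_t}\Big(\omega-\omega Q_t^2-\frac{\tau(\omega Q_t^2+1)}{2\lambda_t}\Big).$$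
   Context: Data (spiked covariance model): for each $p$, $\boldsymbol{\xi}=\boldsymbol{\xi}^{(p)}\in\mathbb{R}^p$ is a fixed vector with $\|\boldsymbol{\xi}\|=\sqrt p$. The samples are $\mathbf{y}_k=\sqrt{\omega/p}\,c_k\boldsymbol{\xi}+\mathbf{a}_k$, $k\ge0$, where $c_k\sim\mathcal{N}(0,1)$ and $\mathbf{a}_k\sim\mathcal{N}(0,\mathbf{I}_p)$ are independent of each other, independent over $k$, and independent of $\mathbf{x}_0$. Algorithm (INO-PCA): $\mathbf{x}_{k+1}=\mathbf{x}_k+\frac{\tau}{p}\big(\mathbf{y}_k\mathbf{y}_k^\top\frac{\mathbf{x}_k}{\lambda_k}-\mathbf{x}_k\big)$ with $\lambda_k=\|\mathbf{x}_k\|/\sqrt p$. The cosine similarity at step $k$ is $Q_k=\boldsymbol{\xi}^\top\mathbf{x}_k/(p\lambda_k)$. Empirical measures: $\mu_k^p=\frac1p\sum_{i=1}^p\delta_{(x_k^i,\xi^i)}\in\mathcal{M}(\mathbb{R}^2)$ (probability measures on $\mathbb{R}^2$), with $\langle f,\mu\rangle$ denoting the integral of $f(x,\xi)$ against $\mu$. The process $t\mapsto\mu^p_{\lfloor pt\rfloor}$ is a random element of the Skorokhod space $\mathcal{D}(\mathbb{R}^+,\mathcal{M}(\mathbb{R}^2))$, and convergence is weak convergence there. A random vector is exchangeable if its law is invariant under coordinate permutations; $\lambda_0=\Theta(1)$ means bounded above and away from $0$ uniformly in $p$. Weak-form PDE: for every positive, bounded, $C^3$ function $f:\mathbb{R}^2\to\mathbb{R}$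 and all $t\ge0$, $$\langle f,\mu_t\rangle-\langle f,\mu_0\rangle=\int_0^t\Big\langle G(x,\lambda_{\hat t},\xi,Q_{\hat t})\frac{\partial f}{\partial x},\mu_{\hat t}\Big\rangle d\hat t+\frac12\int_0^t\Big\langle J(Q_{\hat t})\frac{\partial^2 f}{\partial x^2},\mu_{\hat t}\Big\rangle d\hat t,$$ with $G(x,\lambda,\xi,Q)=\tau(\omega Q\xi+x/\lambda-x)$, $J(Q)=\tau^2(\omega Q^2+1)$, $\lambda_t=\sqrt{\langle x^2,\mu_t\rangle}$ and $Q_t=\langle x\xi,\mu_t\rangle/\lambda_t$. (Under the stated assumptions, the weak convergence of $\mu^p_{\lfloor pt\rfloor}$ to the unique solution of this PDE is an established result of the same paper.) *)

(* Defs.v *)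
From HB Require Import structures.
From mathcomp Require Import all_boot all_order all_algebra perm.
From mathcomp Require Import all_classical all_reals all_analysis.

Set Implicit Arguments.
Unset Strict Implicit.
Unset Printing Implicit Defensive.

Import Order.TTheory GRing.Theory Num.Theory.
Import numFieldNormedType.Exports.

Local Open Scope classical_set_scope.
Local Open Scope ring_scope.

(* Mutual independence of a family of sigma-algebras. *)
Definition mutually_independent (d : measure_display) (T : measurableType d)
    (R : realType) (P : probability T R) (I : choiceType)
    (G : I -> set_system T) : Prop :=
  forall (s : seq I) (A : I -> set T), uniq s ->
    (forall i, i \in s -> G i (A i)) ->
    P (\bigcap_(i in [set` s]) A i) = (\prod_(i <- s) P (A i))%E.

Definition sigma_of (d d' : measure_display) (T : measurableType d)
    (T' : measurableType d') (X : T -> T') : set_system T :=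
  preimage_set_system setT X measurable.

Definition standard_normal (d : measure_display) (T : measurableType d)
    (R : realType) (P : probability T R) (X : T -> R) : Prop :=
  measurable_fun setT X /\
  forall A : set R, measurable A -> P (X @^-1` A) = normal_prob 0 1 A.

(* The law N(0, I_p). *)
Definition standard_normal_vector (d : measure_display) (T : measurableType d)
    (R : realType) (P : probability T R) (p : nat) (X : T -> p.-tuple R) :=
  (forall i : 'I_p, standard_normal P (fun w => tnth (X w) i)) /\
  mutually_independent P (fun i : 'I_p => sigma_of (fun w => tnth (X w) i)).

Definition exchangeable (d : measure_display) (T : measurableType d)
    (R : realType) (P : probability T R) (p : nat) (X : T -> p.-tuple R) :=
  forall (s : 'S_p) (A : set (p.-tuple R)), measurable A ->
    P (X @^-1` A) = P ((fun w => [tuple tnth (X w) (s i) | i < p]) @^-1` A).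

(* Random vectors are tuple-valued, because tuples carry the product
   sigma-algebra; linear algebra is done on the corresponding columns. *)
Definition vec (R : realType) (p : nat) (v : p.-tuple R) : 'cV[R]_p :=
  \col_i tnth v i.

(* The library norm on matrices is the sup norm. *)
Definition enorm (R : realType) (p : nat) (v : 'cV[R]_p) : R :=
  Num.sqrt (\sum_i v i 0 ^+ 2).

(* x_0, (c_k)_k, (a_k)_k are the sources of randomness in dimension p; in the
   index type of the independence condition, [None] stands for x_0,
   [Some (inl k)] for c_k and [Some (inr k)] for a_k. *)
Definition spiked_inputs (d : measure_display) (T : measurableType d)
    (R : realType) (P : probability T R) (p : nat) (x0 : {RV P >-> p.-tuple R})
    (c : nat -> {RV P >-> R}) (a : nat -> {RV P >-> p.-tuple R}) : Prop :=
  [/\ forall k, standard_normal P (c k),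
      forall k, standard_normal_vector P (a k) &
      mutually_independent P (fun i : option (nat + nat) =>
        match i with
        | None => sigma_of x0
        | Some (inl k) => sigma_of (c k)
        | Some (inr k) => sigma_of (a k)
        end)].

Section algorithm.
Context {R : realType} {p : nat}.
Implicit Types (x y xi a : 'cV[R]_p) (c omega tau : R).

Definition spiked_sample omega xi c a : 'cV[R]_p :=
  (Num.sqrt (omega / p%:R) * c) *: xi + a.

Definition rms x : R := enorm x / Num.sqrt p%:R.

Definition ino_pca_step tau x y : 'cV[R]_p :=
  x + (tau / p%:R) *: (y *m y^T *m ((rms x)^-1 *: x) - x).

Fixpoint ino_pca tau x0 (y : nat -> 'cV[R]_p) (k : nat) : 'cV[R]_p :=
  if k is k'.+1 then ino_pca_step tau (ino_pca tau x0 y k') (y k') else x0.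

End algorithm.

Definition pmeasure2 (R : realType) := probability (R * R)%type R.

Section empirical.
Context {R : realType} {n : nat}.
Variables x xi : 'cV[R]_n.+1.

Definition empirical : set (R * R) -> \bar R :=
  mscale (n.+1%:R^-1%:nng : {nonneg R})
    (msum (fun i : nat => \d_(x (inord i) 0, xi (inord i) 0)) n.+1).

HB.instance Definition _ := Measure.on empirical.

Let empirical_setT : empirical setT = 1%E.
Proof.
rewrite /empirical /mscale /= /msum.
rewrite (eq_bigr (fun=> 1%:E)) => [|i _]; last exact: diracT.
rewrite sumEFin sumr_const card_ord -EFinM.
by rewrite mulVf// pnatr_eq0.
Qed.

HB.instance Definition _ := Measure_isProbability.Build _ _ _ empirical
  empirical_setT.

End empirical.

Lemma empiricalE (R : realType) (n : nat) (x xi : 'cV[R]_n.+1)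
    (A : set (R * R)) :
  empirical x xi A =
    (n.+1%:R^-1%:E * \sum_(i < n.+1) \d_(x i ord0, xi i ord0) A)%E.
Proof.
rewrite /empirical /mscale /= /msum; congr (_ * _)%E.
by apply: eq_bigr => i _; rewrite inord_val.
Qed.

(* Weak convergence in M(R^2), along an arbitrary filter. *)
Definition weakly_cvg (R : realType) (I : Type) (F : set_system I)
    (u : I -> pmeasure2 R) (l : pmeasure2 R) : Prop :=
  forall f : R * R -> R, continuous f ->
    (exists B : R, forall z, `|f z| <= B) ->
    \int[u i]_z f z @[i --> F] --> \int[l]_z f z.

(* Paths are defined on R; only their values on [0, +oo[ matter. *)
Definition cadlag (R : realType) (m : R -> pmeasure2 R) : Prop :=
  (forall t : R, 0 <= t -> weakly_cvg (t^'+) m (m t)) /\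
  (forall t : R, 0 < t -> exists l, weakly_cvg (t^'-) m l).

(* The Skorokhod space D(R+, M(R^2)). *)
Record skorokhod (R : realType) := Skorokhod {
  path_of :> R -> pmeasure2 R;
  path_cadlag : cadlag path_of }.

Definition time_change (R : realType) (l : R -> R) : Prop :=
  set_bij `[0, +oo[%classic `[0, +oo[%classic l /\
  {in `[0, +oo[ &, {homo l : s t / s < t}}.

(* Convergence of sequences for the Skorokhod J1 topology. Uniform convergence
   on [0, T] is tested on each bounded continuous f; since the limit path is
   relatively compact on [0, T], this agrees with uniform convergence for any
   metric inducing the weak topology of M(R^2). *)
Definition skorokhod_cvg (R : realType) (u : nat -> skorokhod R)
    (m : skorokhod R) : Prop :=
  exists l : nat -> R -> R,
  [/\ forall n, time_change (l n),
      forall e : R, 0 < e ->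
        \forall n \near \oo, forall s : R, 0 <= s -> `|l n s - s| <= e &
      forall (f : R * R -> R), continuous f ->
        (exists B : R, forall z, `|f z| <= B) ->
        forall T e : R, 0 < e ->
        \forall n \near \oo, forall s : R, 0 <= s <= T ->
          `|\int[u n (l n s)]_z f z - \int[m s]_z f z| <= e].

(* Weak convergence of random elements X_n of E to the constant l. The spaces
   E of interest, M(R^2) and D(R+, M(R^2)), are metrizable, so that continuity
   on E is sequential continuity; [cvgE] is the convergence of sequences. *)
Definition cvg_in_law_to_cst (R : realType) (E : Type)
    (cvgE : (nat -> E) -> E -> Prop) (d : nat -> measure_display)
    (T : forall n, measurableType (d n)) (P : forall n, probability (T n) R)
    (X : forall n, T n -> E) (l : E) : Prop :=
  forall F : E -> R,
    (forall u v, cvgE u v -> F (u n) @[n --> \oo] --> F v) ->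
    (exists B : R, forall x, `|F x| <= B) ->
    'E_(P n)[F \o X n]%E @[n --> \oo] --> (F l)%:E.

Lemma cadlag_step (R : realType) (u : nat -> pmeasure2 R) (p : R) : 0 < p ->
  cadlag (fun t => u (Num.truncn (p * t))).
Proof.
move=> p0; split=> t t0 /=.
  have pt0 : 0 <= p * t by rewrite mulr_ge0// ltW.
  have /andP[h1 h2] := truncn_itv pt0.
  move=> f _ _; apply: cvg_near_cst; near=> s.
  have ts : t < s by near: s; exact: nbhs_right_gt.
  suff -> : Num.truncn (p * s) = Num.truncn (p * t) by [].
  apply: truncn_def; apply/andP; split.
    by rewrite (le_trans h1)// ler_pM2l// ltW.
  rewrite mulrC -(ltr_pdivlMr _ _ p0); near: s; apply: nbhs_right_lt.
  by rewrite (ltr_pdivlMr _ _ p0) [t * p]mulrC; exact: h2.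
have pt0 : 0 < p * t by rewrite mulr_gt0.
have [k [k1 k2]] : exists k : nat, k%:R < p * t /\ p * t <= k.+1%:R.
  have /andP[h1 h2] := truncn_itv (ltW pt0).
  move: h1; rewrite le_eqVlt => /orP[/eqP h1|h1]; last first.
    by exists (Num.truncn (p * t)); split => //; exact: ltW.
  exists (Num.truncn (p * t)).-1.
  have k0 : (0 < Num.truncn (p * t))%N by rewrite -(ltr0n R) h1.
  by rewrite prednK// h1; split=> //; rewrite -[ltRHS]h1 ltr_nat prednK.
exists (u k) => f _ _; apply: cvg_near_cst; near=> s.
suff -> : Num.truncn (p * s) = k by [].
apply: truncn_def; apply/andP; split.
  rewrite ltW// mulrC -(ltr_pdivrMr _ _ p0); near: s; apply: nbhs_left_gt.
  by rewrite (ltr_pdivrMr _ _ p0) [t * p]mulrC.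
rewrite (lt_le_trans _ k2)// (ltr_pM2l p0); near: s; exact: nbhs_left_lt.
Unshelve. all: by end_near. Qed.

Section processes.
Context {R : realType} {n : nat} {d : measure_display} {T : measurableType d}.
Context {P : probability T R}.
Variables (omega tau : R) (xi : 'cV[R]_n.+1) (x0 : {RV P >-> n.+1.-tuple R}).
Variables (c : nat -> {RV P >-> R}) (a : nat -> {RV P >-> n.+1.-tuple R}).

(* The iterate x_k, in dimension p = n + 1. *)
Definition iterate (k : nat) (w : T) : 'cV[R]_n.+1 :=
  ino_pca tau (vec (x0 w))
    (fun j => spiked_sample omega xi (c j w) (vec (a j w))) k.

Definition empirical_at (k : nat) (w : T) : pmeasure2 R :=
  empirical (iterate k w) xi.

(* t |-> mu^p_(floor (p t)) *)
Definition empirical_process (w : T) : skorokhod R :=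
  Skorokhod (@cadlag_step R (empirical_at ^~ w) n.+1%:R (ltr0Sn R n)).

End processes.

Section pde.
Context {R : realType}.
Implicit Types (f : R * R -> R) (mu : pmeasure2 R) (omega tau : R).

Definition d_x f : R * R -> R := fun z => derive1 (fun u => f (u, z.2)) z.1.
Definition d_xi f : R * R -> R := fun z => derive1 (fun u => f (z.1, u)) z.2.

(* Functions of class C^k on R^2. *)
Fixpoint class_C (k : nat) f : Prop :=
  continuous f /\
  if k is k'.+1 then
    [/\ forall z, derivable (fun u => f (u, z.2)) z.1 1,
        forall z, derivable (fun u => f (z.1, u)) z.2 1,
        class_C k' (d_x f) & class_C k' (d_xi f)]
  else True.

Definition lambda_of mu : R := Num.sqrt (\int[mu]_z (z.1 ^+ 2)).
Definition cosine_of mu : R := (\int[mu]_z (z.1 * z.2)) / lambda_of mu.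

Definition driftG omega tau (x lambda xi Q : R) : R :=
  tau * (omega * Q * xi + x / lambda - x).
Definition diffusionJ omega tau (Q : R) : R :=
  tau ^+ 2 * (omega * Q ^+ 2 + 1).

Definition drift_term omega tau f mu : R * R -> R := fun z =>
  driftG omega tau z.1 (lambda_of mu) z.2 (cosine_of mu) * d_x f z.
Definition diffusion_term omega tau f mu : R * R -> R := fun z =>
  diffusionJ omega tau (cosine_of mu) * d_x (d_x f) z.

(* The first clause says that lambda_t and Q_t are meaningful and that one may
   divide by lambda_t. In the second one, the derivatives of a bounded C^3
   function may be unbounded, so that the equation is only required for the f
   for which its right-hand side exists, i.e. both double integrals converge
   absolutely. *)
Definition weak_solution omega tau (mu : skorokhod R) : Prop :=
  (forall t : R, 0 <= t ->
    [/\ (mu t).-integrable setT (fun z => (z.1 ^+ 2)%:E),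
        (mu t).-integrable setT (fun z => (z.1 * z.2)%:E) &
        0 < lambda_of (mu t)]) /\
  forall f, (forall z, 0 < f z) -> (exists B : R, forall z, f z <= B) ->
    class_C 3 f ->
    forall t : R, 0 <= t ->
    (\int[lebesgue_measure]_(s in `[0%R, t])
       \int[mu s]_z `|drift_term omega tau f (mu s) z|%:E < +oo)%E ->
    (\int[lebesgue_measure]_(s in `[0%R, t])
       \int[mu s]_z `|diffusion_term omega tau f (mu s) z|%:E < +oo)%E ->
    \int[mu t]_z f z - \int[mu 0]_z f z =
      \int[lebesgue_measure]_(s in `[0, t])
        \int[mu s]_z drift_term omega tau f (mu s) z
      + 2^-1 * \int[lebesgue_measure]_(s in `[0, t])
        \int[mu s]_z diffusion_term omega tau f (mu s) z.

(* The solution with its own initial condition mu 0 is unique; measures are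
   compared on measurable sets, the only ones on which they are determined. *)
Definition unique_weak_solution omega tau (mu : skorokhod R) : Prop :=
  weak_solution omega tau mu /\
  forall nu : skorokhod R, weak_solution omega tau nu ->
    (forall A, measurable A -> nu 0 A = mu 0 A) ->
    forall t A, 0 <= t -> measurable A -> nu t A = mu t A.

(* The derivative in time is two-sided for t > 0, one-sided at t = 0. *)
Definition cosine_ode omega tau (mu : skorokhod R) : Prop :=
  let Q t := cosine_of (mu t) in
  let lambda t := lambda_of (mu t) in
  let rate t := tau * Q t / lambda t *
    (omega - omega * Q t ^+ 2
     - tau * (omega * Q t ^+ 2 + 1) / (2 * lambda t)) in
  (forall t : R, 0 < t -> is_derive t (1 : R) Q (rate t)) /\
  h^-1 * (Q h - Q 0) @[h --> (0 : R)^'+] --> rate 0.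

End pde.

(* Main.v *)
(* The spike marginal of mu_t does not move, and the fourth moment bound gives
   <xi^2, mu_0> = lim |xi|^2 / p = 1, hence <xi^2, mu_t> = 1 and |Q_t| <= 1.
   Since x^2 and x xi are neither bounded nor positive, the equation is first
   tested on rational truncations such as x^2 / (1 + (e x)^2); for these the
   singular term x f'(x) / lambda is controlled by Cauchy-Schwarz, without any
   lower bound on lambda. A bound on <x^2, mu_t> that is uniform in e and local
   in t follows, and letting e tend to 0 yields
     lambda_t^2 - lambda_0^2
       = int_0^t 2 tau (omega Q^2 lambda + lambda - lambda^2)
                 + tau^2 (omega Q^2 + 1),
     Q_t lambda_t - Q_0 lambda_0 = int_0^t tau (omega Q + Q - Q lambda).
   So lambda and Q are continuous, the integrals are C^1, and the ODE is the
   quotient rule. *)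

Require Import Defs.
From HB Require Import structures.
From mathcomp Require Import all_boot all_order all_algebra.
From mathcomp Require Import all_classical all_reals all_analysis.
From mathcomp Require Import measurable_realfun ring lra.

Set Implicit Arguments.
Unset Strict Implicit.
Unset Printing Implicit Defensive.

Import Order.TTheory GRing.Theory Num.Theory.
Import numFieldNormedType.Exports.

Local Open Scope classical_set_scope.
Local Open Scope ring_scope.

(** * Integration and measurability *)

Section integration.
Context d (T : measurableType d) (R : realType).
Variable m : {measure set T -> \bar R}.

(** The weak equation may be used only for test functions whose two double integrals converge
    absolutely, which calls for moment bounds uniform in time. A solution provides none: its second
    moment is finite at each time, but not a priori locally bounded. Bounds therefore come at two
    levels: crude ones, depending on the truncation, give access to the equation, and the equation
    then gives one that does not depend on it. The estimate closes because [f = x^2 / (1 + (e x)^2)]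
    satisfies [0 <= x f' <= 2 f], so that the drift of [<f, mu_t>] is controlled by [<f, mu_t>]
    itself. Rational truncations also stay in one family under differentiation, which reduces
    smoothness to an induction. The other obstacle is regularity in time. A weakly cadlag path says
    nothing about integrals of unbounded functions: measurability of the moments is obtained through
    bounded cut-offs, and their continuity only at the end, from the integral equations. *)

Lemma Rintegral_dominated_cvg (D : set T) (f_ : nat -> T -> R) (f g : T -> R) :
  measurable D -> (forall n, measurable_fun D (f_ n)) ->
  (forall x, D x -> f_ n x @[n --> \oo] --> f x) ->
  m.-integrable D (EFin \o g) ->
  (forall n x, D x -> `|f_ n x| <= g x) ->
  \int[m]_(x in D) f_ n x @[n --> \oo] --> \int[m]_(x in D) f x.
Proof.
move=> mD mf_ ff ig fg.
have mf : measurable_fun D f := measurable_fun_cvg mf_ ff.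
have intf : m.-integrable D (EFin \o f).
  apply: le_integrable ig => //; first exact/measurable_EFinP.
  move=> x Dx /=; rewrite lee_fin (le_trans _ (ler_norm _))//.
  apply: ler_cvg_to (cvg_norm (ff x Dx)) (cvg_cst (g x)) _.
  by apply: nearW => n; exact: fg.
apply: fine_cvg; rewrite fineK; last exact: integrable_fin_num.
apply: dominated_cvg ig _ => //.
- by move=> n; exact/measurable_EFinP.
- by move=> x Dx; apply: cvg_EFin; [exact: nearW|exact: ff].
Qed.

(* The integral of a nonnegative function is a supremum over simple functions
   even when the function is not measurable. *)
Lemma le_integral_nonmeasurable (D : set T) (f g : T -> \bar R) :
  (forall x, D x -> 0 <= f x)%E -> (forall x, D x -> f x <= g x)%E ->
  (\int[m]_(x in D) f x <= \int[m]_(x in D) g x)%E.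
Proof.
move=> f0 fg.
have g0 x : D x -> (0 <= g x)%E by move=> Dx; exact: le_trans (f0 _ Dx) (fg _ Dx).
rewrite !ge0_integralE//; apply: ge_ereal_sup => _ [h hf <-].
apply: ereal_sup_ubound; exists h => // x; apply: le_trans (hf x) _.
by rewrite /patch; case: ifPn => // /set_mem; exact: fg.
Qed.

End integration.

Lemma measurable_truncn (R : realType) : measurable_fun setT (@Num.truncn R).
Proof.
move=> _ B _; rewrite setTI.
have -> : @Num.truncn R @^-1` B = \bigcup_(k in B) (@Num.truncn R @^-1` [set k]).
  apply/seteqP; split => [x Bx|x [k Bk /= -> //]].
  by exists (Num.truncn x).
have mle k : measurable [set x : R | (Num.truncn x <= k)%N].
  rewrite (_ : [set _ | _] = `]-oo, k.+1%:R[%classic); first exact: measurable_itv.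
  by apply/seteqP; split => x /=; rewrite in_itv/= truncn_le_nat.
apply: bigcup_measurable => -[_|k _].
  rewrite (_ : _ @^-1` _ = [set x : R | (Num.truncn x <= 0)%N])//.
  by apply/seteqP; split => x /=; [move=> ->|rewrite leqn0 => /eqP].
rewrite (_ : _ @^-1` _ = [set x : R | (Num.truncn x <= k.+1)%N] `\`
    [set x : R | (Num.truncn x <= k)%N]); first exact: measurableD.
apply/seteqP; split => x /=; first by move=> ->; rewrite leqnn ltnn.
by move=> [h1 /negP]; rewrite -ltnNge => h2; apply/eqP; rewrite eqn_leq h1.
Qed.

(** [f] is the pointwise limit of the step functions that sample it at the next point of the grid of
    mesh [1 / (n + 1)]. The index is the integer part plus one, so that the sampling point lies
    strictly to the right of [x] even when [x] is on the grid, as the filter [t^'+] demands. *)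
Lemma right_continuous_measurable (R : realType) (f : R -> R) :
  (forall t, 0 <= t -> f s @[s --> t^'+] --> f t) ->
  measurable_fun (`[0, +oo[%classic : set R) f.
Proof.
move=> rc.
pose g (n : nat) (x : R) := f ((Num.truncn (n.+1%:R * x)).+1%:R / n.+1%:R).
apply: (measurable_fun_cvg (h := g)).
- move=> n; apply: measurable_funS (_ : measurable_fun setT _) => //.
  apply: (@measurableT_comp _ _ _ _ _ _ (fun k : nat => f (k.+1%:R / n.+1%:R))).
    by [].
  apply: measurableT_comp; first exact: measurable_truncn.
  exact: measurable_funM.
- move=> x /=; rewrite in_itv/= andbT => x0.
  apply/cvgrPdist_lt => e e0.
  have /cvgrPdist_lt/(_ _ e0) := rc x x0.
  move=> [r /= r0 hr]; near=> n.
  have n0 : 0 < n.+1%:R :> R by rewrite ltr0n.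
  have xn : x < (Num.truncn (n.+1%:R * x)).+1%:R / n.+1%:R.
    by rewrite ltr_pdivlMr// mulrC truncnS_gt.
  apply: hr => //=; rewrite ltr0_norm ?subr_lt0// opprB ltrBlDr.
  rewrite ltr_pdivrMr// -natr1 mulrDl.
  have h1 : (Num.truncn (n.+1%:R * x))%:R <= n.+1%:R * x.
    by rewrite truncn_le mulr_ge0// ltW.
  rewrite addrC [ltLHS]addrC [ltRHS]addrC [x * _]mulrC; apply: ler_ltD => //.
  rewrite -ltr_pdivrMr// div1r; near: n.
  by have [N _ hN] := near_infty_natSinv_lt (PosNum r0); exists N.
Unshelve. all: by end_near. Qed.

(** * Rational test functions *)

Section rational_functions.
Context {R : realType}.
Implicit Types (e C x : R) (p q : {poly R}).

Definition den e : {poly R} := 1 + (e ^+ 2) *: 'X^2.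

(* The functions [rat e p b] are closed under differentiation. *)
Definition rat e p (b : nat) (x : R) : R := p.[x] / (den e).[x] ^+ b.

(** Numerator in the quotient rule [(p / d^b)' = (p' d - b d' p) / d^(b+1)], where [d] is [den e].
    The exponent rises by exactly one for every [b], including [0]. *)
Definition rat_deriv e p (b : nat) : {poly R} :=
  p^`() * den e - b%:R *: ((den e)^`() * p).

Lemma denE e x : (den e).[x] = 1 + (e * x) ^+ 2.
Proof. by rewrite /den !hornerE /= exprMn !expr2 !mulrA. Qed.

Lemma den_gt0 e x : 0 < (den e).[x].
Proof. by rewrite denE ltr_wpDr// sqr_ge0. Qed.

Lemma is_derive_rat e p b x :
  is_derive x (1 : R) (rat e p b) (rat e (rat_deriv e p b) b.+1 x).
Proof.
have d0 := lt0r_neq0 (den_gt0 e x).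
have hD : is_derive x (1 : R) (fun y => (den e).[y] ^+ b)
    ((b%:R * (den e).[x] ^+ b.-1) *: (den e)^`().[x]).
  rewrite (_ : (fun _ => _) = horner (den e) ^+ b); last first.
    by apply/funext => y; rewrite exprfctE.
  exact: is_deriveX.
have hV := @is_deriveV R (fun y => (den e).[y] ^+ b) x _ 1
  (expf_neq0 b d0) hD.
apply: is_derive_eq (is_deriveM (is_derive_poly p x) hV) _.
rewrite /rat; have -> : (rat_deriv e p b).[x] = (p^`()).[x] * (den e).[x] -
    b%:R * ((den e)^`().[x] * p.[x]).
  by rewrite /rat_deriv hornerD hornerN hornerZ !hornerM.
move: ((den e)^`().[x]) => d'; rewrite /GRing.scale/=.
case: b {hD hV} => [|b] /=; first by field.
by rewrite !exprS; field; rewrite d0 expf_neq0.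
Qed.

Lemma rat_continuous e p b : continuous (rat e p b).
Proof.
move=> x; apply/differentiable_continuous/derivable1_diffP.
by have [] := is_derive_rat e p b x.
Qed.

(** The constant [C] serves to make test functions positive; it becomes [0] after one
    differentiation, so that both partial derivatives remain in the family. *)
Definition rat2 e C p b q c (z : R * R) : R :=
  C + rat e p b z.1 * rat e q c z.2.

Lemma rat2_continuous e C p b q c : continuous (rat2 e C p b q c).
Proof.
move=> z; apply: cvgD; first exact: cvg_cst.
apply: cvgM.
  apply: (@cvg_comp _ _ _ fst (rat e p b)).
    exact: cvg_fst.
  exact: rat_continuous.
apply: (@cvg_comp _ _ _ snd (rat e q c)).
  exact: cvg_snd.
exact: rat_continuous.
Qed.

Lemma is_derive_rat2x e C p b q c (z : R * R) :
  is_derive z.1 (1 : R) (fun u => rat2 e C p b q c (u, z.2))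
    (rat2 e 0 (rat_deriv e p b) b.+1 q c z).
Proof.
have h := is_deriveM (is_derive_rat e p b z.1)
  (is_derive_cst (rat e q c z.2) z.1 (1 : R)).
rewrite (_ : (fun _ => _) = cst C + rat e p b * cst (rat e q c z.2))//.
apply: is_derive_eq (is_deriveD (is_derive_cst C z.1 1) h) _.
by rewrite /rat2 /cst /GRing.scale/= mulr0 !add0r mulrC.
Qed.

Lemma is_derive_rat2xi e C p b q c (z : R * R) :
  is_derive z.2 (1 : R) (fun u => rat2 e C p b q c (z.1, u))
    (rat2 e 0 p b (rat_deriv e q c) c.+1 z).
Proof.
have h := is_deriveM (is_derive_cst (rat e p b z.1) z.2 (1 : R))
  (is_derive_rat e q c z.2).
rewrite (_ : (fun _ => _) = cst C + cst (rat e p b z.1) * rat e q c)//.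
apply: is_derive_eq (is_deriveD (is_derive_cst C z.2 1) h) _.
by rewrite /rat2 /cst /GRing.scale/= mulr0 addr0.
Qed.

Lemma d_x_rat2 e C p b q c :
  d_x (rat2 e C p b q c) = rat2 e 0 (rat_deriv e p b) b.+1 q c.
Proof.
apply/funext => z; rewrite /d_x derive1E.
by have [_] := is_derive_rat2x e C p b q c z.
Qed.

Lemma d_xi_rat2 e C p b q c :
  d_xi (rat2 e C p b q c) = rat2 e 0 p b (rat_deriv e q c) c.+1.
Proof.
apply/funext => z; rewrite /d_xi derive1E.
by have [_] := is_derive_rat2xi e C p b q c z.
Qed.

Lemma class_C_rat2 k e C p b q c : class_C k (rat2 e C p b q c).
Proof.
elim: k C p b q c => [|k IH] C p b q c /=.
  by split=> //; exact: rat2_continuous.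
split; first exact: rat2_continuous.
rewrite d_x_rat2 d_xi_rat2; split=> //.
  by move=> z; have [] := is_derive_rat2x e C p b q c z.
by move=> z; have [] := is_derive_rat2xi e C p b q c z.
Qed.

End rational_functions.

(** * Functions of quadratic growth *)

Section quadratic_growth.
Context {R : realType}.
Implicit Types (m : pmeasure2 R) (g h : R * R -> R).

Definition quad (z : R * R) : R := 1 + z.1 ^+ 2 + z.2 ^+ 2.

Lemma quad_ge1 z : 1 <= quad z.
Proof. by rewrite /quad -addrA lerDl addr_ge0 ?sqr_ge0. Qed.

(** Growth gives integrability at each time. Continuity gives measurability in time, since weak
    right continuity of the path only sees continuous functions. *)
Definition quadratic_growth g : Prop :=
  [/\ continuous g, measurable_fun setT g &
      exists a : R, forall z, `|g z| <= a * quad z].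

Lemma Rintegral_linear2 d (T : measurableType d)
    (m : {measure set T -> \bar R}) (D : set T) (a b : R) (f g : T -> R) :
  measurable D -> m.-integrable D (EFin \o f) -> m.-integrable D (EFin \o g) ->
  \int[m]_(x in D) (a * f x + b * g x) =
  a * \int[m]_(x in D) f x + b * \int[m]_(x in D) g x.
Proof.
move=> mD fi gi; rewrite RintegralD//; last 2 first.
- by apply: eq_integrable (integrableZl mD a fi).
- by apply: eq_integrable (integrableZl mD b gi).
by rewrite !RintegralZl.
Qed.

Lemma bounded_itv_integrable (h : R -> R) (a b B : R) :
  measurable_fun `[a, b] h -> (forall s, a <= s <= b -> `|h s| <= B) ->
  lebesgue_measure.-integrable `[a, b] (EFin \o h).
Proof.
move=> mh hB; apply: (@le_integrable _ _ _ _ _ _ _ (cst B%:E)) => //.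
- exact/measurable_EFinP.
- move=> s; rewrite /= in_itv/= => /hB h1.
  by rewrite lee_fin (le_trans h1)// ler_norm.
- apply/integrableP; split; first exact/measurable_EFinP.
  rewrite integral_cst//= lebesgue_measure_itv; case: ifP => _ /=.
    by rewrite ltry.
  by rewrite mule0.
Qed.

Section second_moments.
Variable m : pmeasure2 R.
Hypothesis mx : m.-integrable setT (fun z => (z.1 ^+ 2)%:E).
Hypothesis mxi : m.-integrable setT (fun z => (z.2 ^+ 2)%:E).

Lemma quad_integrable : m.-integrable setT (EFin \o quad).
Proof.
rewrite (_ : _ \o _ =
    ((cst 1%:E \+ (fun z => (z.1 ^+ 2)%:E)) \+ (fun z => (z.2 ^+ 2)%:E))%E) //.
apply: integrableD => //; apply: integrableD => //.
exact: finite_measure_integrable_cst.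
Qed.

Lemma quadratic_growth_integrable g (a : R) :
  measurable_fun setT g -> (forall z, `|g z| <= a * quad z) ->
  m.-integrable setT (EFin \o g).
Proof.
move=> mg ga; have := integrableZl measurableT a quad_integrable.
apply: le_integrable => //; first exact/measurable_EFinP.
by move=> z _ /=; rewrite lee_fin (le_trans (ga z))// ler_norm.
Qed.

End second_moments.

End quadratic_growth.

(** * Truncated squares and their limits as the truncation is removed *)

Section truncations.
Context {R : realType}.
Implicit Types (e x : R).

Lemma rat_sqrE e x : rat e 'X^2 1 x = x ^+ 2 / (1 + (e * x) ^+ 2).
Proof. by rewrite /rat denE expr1 hornerXn. Qed.

Lemma rat_sqr_ge0 e x : 0 <= rat e 'X^2 1 x.
Proof. by rewrite rat_sqrE divr_ge0 ?sqr_ge0// addr_ge0 ?sqr_ge0. Qed.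

Lemma rat_sqr_le e x : rat e 'X^2 1 x <= x ^+ 2.
Proof.
rewrite rat_sqrE ler_pdivrMr -?denE ?den_gt0// denE mulrDr mulr1 lerDl.
by rewrite mulr_ge0 ?sqr_ge0.
Qed.

Lemma rat_sqr_bounded e x : 0 < e -> rat e 'X^2 1 x <= e ^- 2.
Proof.
move=> e0; rewrite rat_sqrE ler_pdivrMr -?denE ?den_gt0// denE exprMn mulrDr.
by rewrite mulr1 mulKf ?expf_neq0 ?gt_eqF// lerDr invr_ge0 sqr_ge0.
Qed.

Definition eps (n : nat) : R := n.+1%:R^-1.

Lemma eps_gt0 n : 0 < eps n. Proof. by rewrite invr_gt0. Qed.

Lemma eps_le1 n : eps n <= 1.
Proof. by rewrite invf_le1// ler1n. Qed.

Lemma eps_cvg : eps n @[n --> \oo] --> (0 : R).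
Proof. exact: cvg_harmonic. Qed.

Lemma den_cvg x : (den (eps n)).[x] @[n --> \oo] --> (1 : R).
Proof.
under eq_fun do rewrite denE.
suff : 1 + (eps n * x) ^+ 2 @[n --> \oo] --> 1 + (0 * x) ^+ 2.
  by rewrite mul0r expr0n addr0.
apply: cvgD; first exact: cvg_cst.
apply: (@cvg_comp _ _ _ _ (fun y : R => y ^+ 2) _ _ _ _ (@exprn_continuous _ 2 _)).
by apply: cvgMl; exact: eps_cvg.
Qed.

Lemma rat_cvg p b x : rat (eps n) p b x @[n --> \oo] --> p.[x].
Proof.
suff : rat (eps n) p b x @[n --> \oo] --> p.[x] / 1 ^+ b.
  by rewrite expr1n divr1.
apply: cvgMr; apply: cvgV; first by rewrite expr1n oner_neq0.
apply: (@cvg_comp _ _ _ _ (fun y : R => y ^+ b) _ _ _ _ (@exprn_continuous _ b _)).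
exact: den_cvg.
Qed.

Lemma rat_sqr_mono x : {homo (fun n => rat (eps n) 'X^2 1 x) : n m / (n <= m)%N >-> n <= m}.
Proof.
move=> n m nm; rewrite !rat_sqrE ler_wpM2l ?sqr_ge0//.
rewrite lef_pV2 ?posrE -?denE ?den_gt0// !denE lerD2l !exprMn ler_wpM2r ?sqr_ge0//.
rewrite lerXn2r ?nnegrE ?(ltW (eps_gt0 _))// /eps.
by rewrite lef_pV2 ?posrE// ler_nat.
Qed.

(** Monotone convergence, with values in the extended reals: finiteness of the second moment of the
    spike is not assumed here but will be read off from this limit. *)
Lemma second_moment_xi_cvg (m : pmeasure2 R) :
  (\int[m]_z (rat (eps n) 'X^2 1 z.2)%:E @[n --> \oo] -->
   \int[m]_z (z.2 ^+ 2)%:E)%E.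
Proof.
apply: cvg_trans; first apply: (@cvg_monotone_convergence _ _ _ m setT measurableT
    (fun n z => (rat (eps n) 'X^2 1 z.2)%:E)).
- move=> n; apply/measurable_EFinP; apply: measurableT_comp => //.
  by apply: continuous_measurable_fun; exact: rat_continuous.
- by move=> n z _; rewrite lee_fin rat_sqr_ge0.
- by move=> z _ n k nk; rewrite lee_fin; exact: rat_sqr_mono.
rewrite (_ : (\int[m]_x _)%E = (\int[m]_z (z.2 ^+ 2)%:E)%E)//.
apply: eq_integral => z _; apply: cvg_lim => //; apply: cvg_EFin.
  exact: nearW.
have <- : 'X^2.[z.2 : R] = z.2 ^+ 2 by rewrite hornerXn.
exact: rat_cvg.
Qed.

End truncations.

(** * The second moment of the spike *)

Section empirical_moments.
Context {R : realType}.

Lemma ge0_integral_empirical n (x xi : 'cV[R]_n.+1) (f : R * R -> R) :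
  measurable_fun setT f -> (forall z, 0 <= f z) ->
  (\int[empirical x xi]_z (f z)%:E =
   (n.+1%:R^-1 * \sum_(i < n.+1) f (x i 0, xi i 0))%:E)%E.
Proof.
move=> mf f0; have mEf : measurable_fun setT (EFin \o f) by exact/measurable_EFinP.
have f0' z : setT z -> (0 <= (f z)%:E)%E by rewrite lee_fin.
rewrite /empirical ge0_integral_mscale// ge0_integral_measure_sum// EFinM -sumEFin.
congr (_ * _)%E; apply: eq_bigr => i _.
by rewrite integral_dirac// diracT mul1e inord_val.
Qed.

Lemma bounded_integrable (m : pmeasure2 R) (g : R * R -> R) (B : R) :
  measurable_fun setT g -> (forall z, `|g z| <= B) ->
  m.-integrable setT (EFin \o g).
Proof.
move=> mg gB; have := finite_measure_integrable_cst m B measurableT.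
apply: le_integrable => //; first exact/measurable_EFinP.
by move=> z _ /=; rewrite lee_fin (le_trans (gB z))// ler_norm.
Qed.

Lemma Rintegral_prob_cst (m : pmeasure2 R) (c : R) : \int[m]_z c = c.
Proof.
rewrite Rintegral_cst//; have -> : fine (m setT) = 1 by rewrite probability_setT.
by rewrite mulr1.
Qed.

Lemma bounded_Rintegral_le (m : pmeasure2 R) (g : R * R -> R) (B : R) :
  measurable_fun setT g -> (forall z, `|g z| <= B) -> `|\int[m]_z g z| <= B.
Proof.
move=> mg gB; have ig := bounded_integrable m mg gB.
apply: le_trans (le_normr_Rintegral measurableT ig) _.
apply: (@le_trans _ _ (\int[m]_z (cst B z))).
  apply: le_Rintegral => //; last exact: finite_measure_integrable_cst.
  by apply: (@bounded_integrable _ _ B) => [|z];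
    [exact: measurableT_comp|rewrite normr_id].
by rewrite Rintegral_prob_cst.
Qed.

Lemma measurable_rat_sqr_xi e :
  measurable_fun setT (fun z : R * R => rat e 'X^2 1 z.2).
Proof.
apply: measurableT_comp => //.
by apply: continuous_measurable_fun; exact: rat_continuous.
Qed.

Lemma rat_sqr_norm_bounded (e x : R) : 0 < e -> `|rat e 'X^2 1 x| <= e ^- 2.
Proof. by move=> e0; rewrite ger0_norm ?rat_sqr_ge0// rat_sqr_bounded. Qed.

(** With [u = (e x)^2], the truncation loses [x^2 u / (1 + u) <= e^2 x^4]. This is how the fourth
    moment controls the loss uniformly in the dimension. *)
Lemma sqr_sub_rat_le (e x : R) : x ^+ 2 - e ^+ 2 * x ^+ 4 <= rat e 'X^2 1 x.
Proof.
rewrite rat_sqrE ler_pdivlMr -?denE ?den_gt0// denE.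
have -> : (x ^+ 2 - e ^+ 2 * x ^+ 4) * (1 + (e * x) ^+ 2) =
  x ^+ 2 - (e ^+ 2 * x ^+ 3) ^+ 2 by ring.
by rewrite gerBl sqr_ge0.
Qed.

(* The empirical second moments of the spike are exactly 1; the fourth moment
   bound makes them pass to the limit. *)
Lemma initial_second_moment (d : nat -> measure_display)
    (Omega : forall n : nat, measurableType (d n))
    (P : forall n : nat, probability (Omega n) R)
    (xi : forall n : nat, 'cV[R]_n.+1)
    (x0 : forall n : nat, Omega n -> 'cV[R]_n.+1) (C : R) (mu0 : pmeasure2 R) :
  (forall n, enorm (xi n) = Num.sqrt n.+1%:R) ->
  (forall n, {ae P n, forall w,
     (\int[empirical (x0 n w) (xi n)]_z (z.1 ^+ 4 + z.2 ^+ 4)%:E <= C%:E)%E}) ->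
  cvg_in_law_to_cst (weakly_cvg \oo) P
    (fun n w => empirical (x0 n w) (xi n) : pmeasure2 R) mu0 ->
  (\int[mu0]_z (z.2 ^+ 2)%:E = 1)%E.
Proof.
move=> hxi hmom hcvg.
have sum2 n : n.+1%:R^-1 * \sum_(i < n.+1) xi n i 0 ^+ 2 = 1.
  have /eqP := hxi n; rewrite /enorm eqr_sqrt ?ler0n// => [/eqP ->|].
    by rewrite mulVf.
  by apply: sumr_ge0 => i _; rewrite sqr_ge0.
have sum4 n : n.+1%:R^-1 * \sum_(i < n.+1) xi n i 0 ^+ 4 <= C.
  (* The bound on the spike is deterministic, so one sample point of the almost sure event
     suffices. *)
  have [w hw] : exists w, (\int[empirical (x0 n w) (xi n)]_z
      (z.1 ^+ 4 + z.2 ^+ 4)%:E <= C%:E)%E.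
    have P0 : (0 < P n setT)%E by rewrite probability_setT lte01.
    exact: (@filter_ex _ _ (ae_properfilter_algebraOfSetsType P0) _ (hmom n)).
  move: hw; rewrite (@ge0_integral_empirical _ _ _ (fun z => z.1 ^+ 4 + z.2 ^+ 4)).
  - rewrite lee_fin; apply: le_trans; rewrite ler_wpM2l//.
    by apply: ler_sum => i _; rewrite lerDr /= exprn_even_ge0.
  - apply: measurable_funD; apply: measurable_funX; [exact: measurable_fst|].
    exact: measurable_snd.
  - by move=> z; rewrite addr_ge0// exprn_even_ge0.
(* The truncation is fixed while the dimension tends to infinity. The lower bound is uniform in the
   dimension and tends to [1] as the truncation is removed. *)
have bnd k : 1 - eps k ^+ 2 * C <= \int[mu0]_z rat (eps k) 'X^2 1 z.2 <= 1.
  set e := eps k; have e0 : 0 < e := eps_gt0 k.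
  pose F (m : pmeasure2 R) := \int[m]_z rat e 'X^2 1 z.2.
  have Fcont u v : weakly_cvg \oo u v -> F (u n) @[n --> \oo] --> F v.
    apply; first by move=> z; apply: (@cvg_comp _ _ _ snd (rat e 'X^2 1));
      [exact: cvg_snd|exact: rat_continuous].
    by exists (e ^- 2) => z; exact: rat_sqr_norm_bounded.
  have Fbnd : exists B : R, forall x, `|F x| <= B.
    exists (e ^- 2) => m; apply: bounded_Rintegral_le.
      exact: measurable_rat_sqr_xi.
    by move=> z; exact: rat_sqr_norm_bounded.
  pose c n := n.+1%:R^-1 * \sum_(i < n.+1) rat e 'X^2 1 (xi n i 0).
  have FE n w : F (empirical (x0 n w) (xi n)) = c n.
    rewrite /F /Rintegral ge0_integral_empirical//; first exact: measurable_rat_sqr_xi.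
    by move=> z; exact: rat_sqr_ge0.
  (* [F] of the empirical measure depends on the spike only, hence is the constant [c n], and
     convergence in law becomes convergence of a real sequence. *)
  have cF : c n @[n --> \oo] --> F mu0.
    have := hcvg F Fcont Fbnd; rewrite (_ : (fun n => _) = EFin \o c).
      by move=> /fine_cvg.
    apply/funext => n /=; rewrite -(expectation_cst (P n)); congr expectation.
    by apply/funext => w /=; rewrite FE.
  apply/andP; split.
    apply: ler_cvg_to (cvg_cst _) cF _; apply: nearW => n.
    rewrite -[leLHS](_ : n.+1%:R^-1 * \sum_(i < n.+1) xi n i 0 ^+ 2 -
      e ^+ 2 * C = _); last by rewrite sum2.
    rewrite lerBlDr (le_trans _ (lerD (lexx _) (ler_wpM2l (sqr_ge0 _) (sum4 n))))//.
    rewrite /c mulrCA -mulrDr ler_wpM2l// mulr_sumr -big_split/=.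
    by apply: ler_sum => i _; rewrite -lerBlDr sqr_sub_rat_le.
  apply: ler_cvg_to cF (cvg_cst _) _; apply: nearW => n.
  rewrite -(sum2 n) ler_wpM2l//; apply: ler_sum => i _; exact: rat_sqr_le.
have lim1 : \int[mu0]_z rat (eps k) 'X^2 1 z.2 @[k --> \oo] --> (1 : R).
  apply: (@squeeze_cvgr _ _ _ _ (fun k => 1 - eps k ^+ 2 * C) (cst 1)).
  - by apply: nearW => k; exact: bnd.
  - suff : 1 - eps k ^+ 2 * C @[k --> \oo] --> 1 - 0 ^+ 2 * C.
      by rewrite expr0n mul0r subr0.
    apply: cvgB; first exact: cvg_cst.
    apply: cvgMl; apply: (@cvg_comp _ _ _ _ (fun y : R => y ^+ 2) _ _ _ _
      (@exprn_continuous _ 2 _)); exact: eps_cvg.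
  - exact: cvg_cst.
apply: cvg_unique (@second_moment_xi_cvg R mu0) _ => //.
rewrite (_ : (fun n => _) = EFin \o (fun k => \int[mu0]_z rat (eps k) 'X^2 1 z.2)).
  by apply: cvg_EFin => //; exact: nearW.
apply/funext => k /=; rewrite /Rintegral fineK//; apply: integrable_fin_num => //.
apply: (@bounded_integrable _ _ (eps k ^- 2)) => [|z].
  exact: measurable_rat_sqr_xi.
exact/rat_sqr_norm_bounded/eps_gt0.
Qed.

End empirical_moments.

(** * Products of a function of x and a function of xi *)

Section separated.
Context {R : realType}.
Implicit Types g h : R * R -> R.

Lemma continuous_separated (f1 f2 : R -> R) : continuous f1 -> continuous f2 ->
  continuous (fun z : R * R => f1 z.1 * f2 z.2).
Proof.
move=> c1 c2 z; apply: cvgM.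
  by apply: (@cvg_comp _ _ _ fst f1); [exact: cvg_fst|exact: c1].
by apply: (@cvg_comp _ _ _ snd f2); [exact: cvg_snd|exact: c2].
Qed.

Lemma quadratic_growth_separated (f1 f2 : R -> R) (a : R) :
  continuous f1 -> continuous f2 ->
  (forall x y, `|f1 x * f2 y| <= a * (1 + x ^+ 2 + y ^+ 2)) ->
  quadratic_growth (fun z => f1 z.1 * f2 z.2).
Proof.
move=> c1 c2 h; split; first exact: continuous_separated.
  by apply: measurable_funM; apply: measurableT_comp => //;
    exact: continuous_measurable_fun.
by exists a => -[x y]; exact: h.
Qed.

Lemma quadratic_growth_x2 : quadratic_growth (fun z : R * R => z.1 ^+ 2).
Proof.
rewrite (_ : (fun _ => _) = fun z => z.1 ^+ 2 * 1); last first.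
  by apply/funext => z; rewrite mulr1.
apply: (@quadratic_growth_separated (fun x => x ^+ 2) (fun=> 1) 1).
- exact: exprn_continuous.
- by move=> ?; exact: cvg_cst.
- move=> x y; rewrite mulr1 mul1r ger0_norm ?sqr_ge0//.
  have := sqr_ge0 y; lra.
Qed.

Lemma quadratic_growth_xi2 : quadratic_growth (fun z : R * R => z.2 ^+ 2).
Proof.
rewrite (_ : (fun _ => _) = fun z => 1 * z.2 ^+ 2); last first.
  by apply/funext => z; rewrite mul1r.
apply: (@quadratic_growth_separated (fun=> 1) (fun x => x ^+ 2) 1).
- by move=> ?; exact: cvg_cst.
- exact: exprn_continuous.
- move=> x y; rewrite !mul1r ger0_norm ?sqr_ge0//.
  have := sqr_ge0 x; lra.
Qed.

Lemma normM_le_quad (x y : R) : `|x * y| <= 1 * (1 + x ^+ 2 + y ^+ 2).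
Proof.
rewrite ler_norml mul1r; apply/andP; split; rewrite -subr_ge0.
  have := sqr_ge0 (x + y); have := sqr_ge0 x; have := sqr_ge0 y; nra.
have := sqr_ge0 (x - y); have := sqr_ge0 x; have := sqr_ge0 y; nra.
Qed.

Lemma quadratic_growth_xxi : quadratic_growth (fun z : R * R => z.1 * z.2).
Proof.
apply: (@quadratic_growth_separated id id 1) => //.
by move=> x; exact: cvg_id.
by move=> x; exact: cvg_id.
exact: normM_le_quad.
Qed.

End separated.

(** * Moments along a solution: conservation, measurability in time, Cauchy-Schwarz *)

Section paths.
Context {R : realType}.
Variables (omega tau : R) (mu : skorokhod R).
Implicit Types (g h : R * R -> R) (s t : R).

Lemma rat_deriv_const e : rat_deriv e 1 0 = 0 :> {poly R}.
Proof. by rewrite /rat_deriv derivC mul0r scale0r subr0. Qed.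

Lemma rat_0p e b : rat e 0 b = (fun=> 0) :> (R -> R).
Proof. by apply/funext => x; rewrite /rat horner0 mul0r. Qed.

Lemma rat_1p e : rat e 1 0 = (fun=> 1) :> (R -> R).
Proof. by apply/funext => x; rewrite /rat hornerC expr0 divr1. Qed.

(* A test function of xi alone is transported without change. *)
Lemma weak_solution_second_moment_xi : weak_solution omega tau mu ->
  forall t, 0 <= t ->
  (\int[mu t]_z (z.2 ^+ 2)%:E = \int[mu 0%R]_z (z.2 ^+ 2)%:E)%E.
Proof.
move=> [_ hw] t t0.
have truncated n : (\int[mu t]_z (rat (eps n) 'X^2 1 z.2)%:E =
    \int[mu 0%R]_z (rat (eps n) 'X^2 1 z.2)%:E)%E.
  set e := eps n; have e0 : 0 < e := eps_gt0 n.
  (* The constant [1] ensures strict positivity. Both terms on the right of the equation vanish, so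
     its integrability conditions hold trivially. *)
  pose f : R * R -> R := rat2 e 1 1 0 'X^2 1.
  have fE z : f z = 1 + rat e 'X^2 1 z.2 by rewrite /f /rat2 rat_1p mul1r.
  have ie r : (mu r).-integrable setT (EFin \o (fun z => rat e 'X^2 1 z.2)).
    apply: (@bounded_integrable _ _ _ (e ^- 2)) => [|z].
      exact: measurable_rat_sqr_xi.
    exact: rat_sqr_norm_bounded.
  have i1 r : (mu r).-integrable setT (EFin \o (fun=> 1)).
    exact: finite_measure_integrable_cst.
  have intf r : \int[mu r]_z f z = 1 + \int[mu r]_z rat e 'X^2 1 z.2.
    under eq_Rintegral do rewrite fE.
    by rewrite RintegralD ?Rintegral_prob_cst//; [exact: i1|exact: ie].
  have dxf : d_x f = fun=> 0.
    by rewrite d_x_rat2 rat_deriv_const; apply/funext => z; rewrite /rat2 rat_0p mul0r addr0.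
  have dxxf : d_x (d_x f) = fun=> 0.
    by rewrite dxf; apply/funext => z; rewrite /d_x derive1_cst.
  have drift0 s z : drift_term omega tau f (mu s) z = 0.
    by rewrite /drift_term dxf mulr0.
  have diff0 s z : diffusion_term omega tau f (mu s) z = 0.
    by rewrite /diffusion_term dxxf mulr0.
  have h0 (k : R -> R * R -> R) : (forall s z, k s z = 0) ->
      (\int[lebesgue_measure]_(s in `[0%R, t])
        \int[mu s]_z `|k s z|%:E < +oo :> \bar R)%E.
    move=> k0; rewrite (_ : (fun s => _) = fun=> 0%E) ?integral0 ?ltry//.
    apply/funext => s; rewrite (_ : (fun z => _) = fun=> 0%E) ?integral0//.
    by apply/funext => z; rewrite k0 normr0.
  have I0 (k : R -> R * R -> R) : (forall s z, k s z = 0) ->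
      \int[lebesgue_measure]_(s in `[0, t]) \int[mu s]_z k s z = 0.
    move=> k0; rewrite (_ : (fun s => _) = fun=> 0).
      by rewrite Rintegral_cst// mul0r.
    apply/funext => s; rewrite (_ : (fun z => _) = fun=> 0).
      exact: Rintegral_prob_cst.
    by apply/funext => z; rewrite k0.
  have fpos z : 0 < f z by rewrite fE ltr_pwDl// rat_sqr_ge0.
  have fbnd : exists B : R, forall z, f z <= B.
    by exists (1 + e ^- 2) => z; rewrite fE lerD2l rat_sqr_bounded.
  have := hw f fpos fbnd (class_C_rat2 3 e 1 1 0 'X^2 1) t t0
    (h0 _ drift0) (h0 _ diff0).
  rewrite (I0 _ drift0) (I0 _ diff0) mulr0 addr0 !intf opprD addrACA subrr add0r.
  move=> /eqP; rewrite subr_eq0 => /eqP h.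
  rewrite -[LHS]fineK; last exact: (integrable_fin_num measurableT (ie t)).
  rewrite -[RHS]fineK; last exact: (integrable_fin_num measurableT (ie 0)).
  by congr EFin; exact: h.
have := @second_moment_xi_cvg R (mu t).
rewrite (funext truncated) => h.
exact: cvg_unique h (@second_moment_xi_cvg R (mu 0)).
Qed.

Hypothesis hmu : weak_solution omega tau mu.
Hypothesis hxi : forall t, 0 <= t -> (\int[mu t]_z (z.2 ^+ 2)%:E = 1)%E.

Let E s g := \int[mu s]_z g z.
Let lam s := lambda_of (mu s).
Let Q s := cosine_of (mu s).

Lemma integrable_x2 s : 0 <= s ->
  (mu s).-integrable setT (fun z => (z.1 ^+ 2)%:E).
Proof. by move=> s0; have [] := hmu.1 s s0. Qed.

Lemma integrable_xi2 s : 0 <= s ->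
  (mu s).-integrable setT (fun z => (z.2 ^+ 2)%:E).
Proof.
move=> s0; apply/integrableP; split.
  by apply/measurable_EFinP; apply: measurable_funX; exact: measurable_snd.
rewrite (_ : (\int[_]_x _ = 1)%E) ?ltry// -(hxi s0); apply: eq_integral => z _.
by rewrite gee0_abs// lee_fin sqr_ge0.
Qed.

Lemma quadratic_integrable s g : 0 <= s -> quadratic_growth g ->
  (mu s).-integrable setT (EFin \o g).
Proof.
move=> s0 [_ mg [a ga]].
exact: (quadratic_growth_integrable (integrable_x2 s0) (integrable_xi2 s0) mg ga).
Qed.

(** Multiplied by the cut-off [k n], the function [g] becomes bounded and continuous, so its
    integral is right-continuous in time and hence measurable. Dominated convergence at each fixed
    time removes the cut-off, and measurability passes to the pointwise limit. *)
Lemma measurable_path g : quadratic_growth g ->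
  measurable_fun (`[0, +oo[%classic : set R) (fun s => E s g).
Proof.
move=> [cg mg [a ga]].
have a0 : 0 <= a.
  have := le_trans (normr_ge0 _) (ga (0, 0)).
  by rewrite pmulr_lge0// (lt_le_trans ltr01 (quad_ge1 _)).
pose k n (z : R * R) := rat (eps n) 1 1 z.1 * rat (eps n) 1 1 z.2.
have kE n z : k n z = rat2 (eps n) 0 1 1 1 1 z by rewrite /rat2 add0r.
have mk n : measurable_fun setT (k n).
  apply: measurable_funM; apply: measurableT_comp => //;
  by apply: continuous_measurable_fun; exact: rat_continuous.
have den1 n (x : R) : 1 <= (den (eps n)).[x] by rewrite denE lerDl sqr_ge0.
have k0 n z : 0 <= k n z.
  by rewrite /k /rat !hornerC !mul1r mulr_ge0// invr_ge0 exprn_ge0// ltW// den_gt0.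
have k1 n z : k n z <= 1.
  by rewrite /k /rat !hornerC !mul1r !expr1 mulr_ile1 ?invr_ge0 ?invf_le1 ?(ltW (den_gt0 _ _)) ?den_gt0// den1.
(* With [e = eps n <= 1], [(1 + e^2 x^2) (1 + e^2 y^2) >= e^2 (1 + x^2 + y^2)]. *)
have kq n z : k n z * quad z <= eps n ^- 2.
  rewrite /k /rat !hornerC !mul1r !expr1 -invfM mulrC ler_pdivrMr ?mulr_gt0 ?den_gt0//.
  rewrite mulrC ler_pdivlMr ?exprn_gt0 ?eps_gt0//.
  have e1 : (eps n : R) ^+ 2 <= 1 by apply: exprn_ile1; rewrite ?eps_le1 ?ltW ?eps_gt0.
  rewrite /quad !denE; set e := eps n in e1 *.
  have : 0 <= (e * z.1 * (e * z.2)) ^+ 2 by exact: sqr_ge0.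
  lra.
pose gn n z := k n z * g z.
have gnq n z : `|gn n z| <= a * quad z.
  rewrite /gn normrM (ger0_norm (k0 n z)) (le_trans _ (ga z))//.
  by rewrite ler_piMl.
apply: (@measurable_fun_cvg _ _ _ _ (fun n s => E s (gn n))).
- move=> n; apply: right_continuous_measurable => s s0.
  apply: (mu.(path_cadlag).1 s s0).
    move=> z; apply: cvgM; last exact: cg.
    by rewrite (_ : k n = rat2 (eps n) 0 1 1 1 1);
      [exact: rat2_continuous|apply/funext => y; exact: kE].
  exists (a * eps n ^- 2) => z; rewrite /gn normrM (ger0_norm (k0 n z)).
  rewrite (le_trans (ler_wpM2l (k0 n z) (ga z)))// mulrCA ler_wpM2l//.
- move=> s /=; rewrite in_itv/= andbT => s0.
  apply: (@Rintegral_dominated_cvg _ _ _ _ _ _ _ (fun z => a * quad z)) => //.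
  + by move=> n; apply: measurable_funM.
  + move=> z _; rewrite -[X in _ --> X]mul1r; apply: cvgMl.
    rewrite -[X in _ --> X]mulr1; apply: cvgM.
      by have := @rat_cvg R 1 1 z.1; rewrite hornerC.
    by have := @rat_cvg R 1 1 z.2; rewrite hornerC.
  + exact: eq_integrable (integrableZl measurableT a
      (quad_integrable (integrable_x2 s0) (integrable_xi2 s0))).
Qed.

Lemma lam_gt0 s : 0 <= s -> 0 < lam s.
Proof. by move=> s0; have [] := hmu.1 s s0. Qed.

Lemma sqr_lam s : lam s ^+ 2 = E s (fun z => z.1 ^+ 2).
Proof.
by rewrite sqr_sqrtr//; apply: Rintegral_ge0 => z _; exact: sqr_ge0.
Qed.

Lemma second_moment_xi1 s : 0 <= s -> E s (fun z => z.2 ^+ 2) = 1.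
Proof. by move=> s0; rewrite /E /Rintegral hxi. Qed.

Lemma E_normed_le s g h : 0 <= s -> quadratic_growth g -> quadratic_growth h ->
  (forall z, `|g z| <= h z) -> E s (fun z => `|g z|) <= E s h.
Proof.
move=> s0 qg qh gh; apply: le_Rintegral => //; last exact: quadratic_integrable.
by have := integrable_norm (quadratic_integrable s0 qg).
Qed.

Lemma norm_E_le s g : 0 <= s -> quadratic_growth g ->
  `|E s g| <= E s (fun z => `|g z|).
Proof. by move=> s0 qg; apply: le_normr_Rintegral => //; exact: quadratic_integrable. Qed.

Lemma E_linear2 s a b g h : 0 <= s -> quadratic_growth g -> quadratic_growth h ->
  E s (fun z => a * g z + b * h z) = a * E s g + b * E s h.
Proof. by move=> s0 qg qh; apply: Rintegral_linear2 => //; exact: quadratic_integrable. Qed.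

Lemma quadratic_growth_lin2 a b g h : quadratic_growth g ->
  quadratic_growth h -> quadratic_growth (fun z => a * g z + b * h z).
Proof.
move=> [cg mg [ag gg]] [ch mh [ah hh]]; split.
- move=> z; apply: cvgD; apply: cvgMr; [exact: cg|exact: ch].
- by apply: measurable_funD; exact: measurable_funM.
- exists (`|a| * ag + `|b| * ah) => z.
  rewrite (le_trans (ler_normD _ _))// !normrM mulrDl -!mulrA lerD//.
    by rewrite ler_wpM2l.
  by rewrite ler_wpM2l.
Qed.

(* Cauchy-Schwarz, through [2|x y| <= x^2 / lam + lam y^2]. *)
Lemma E_norm_xxi_le s g (c : R) : 0 <= s -> quadratic_growth g -> 0 <= c ->
  (forall z, `|g z| <= c * `|z.1 * z.2|) -> E s (fun z => `|g z|) <= c * lam s.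
Proof.
move=> s0 qg c0 gc; have l0 := lam_gt0 s0.
have qh := quadratic_growth_lin2 (c / 2 / lam s) (c / 2 * lam s)
  quadratic_growth_x2 quadratic_growth_xi2.
apply: le_trans (E_normed_le s0 qg qh _) _.
  move=> z; apply: le_trans (gc z) _.
  rewrite -subr_ge0 (_ : _ - _ = c / 2 / lam s * (`|z.1| - lam s * `|z.2|) ^+ 2).
    by rewrite mulr_ge0 ?sqr_ge0// !divr_ge0 // ltW.
  rewrite -(real_normK (num_real z.1)) -(real_normK (num_real z.2)) normrM.
  by field; rewrite gt_eqF.
rewrite (E_linear2 _ _ s0 quadratic_growth_x2 quadratic_growth_xi2).
rewrite -sqr_lam second_moment_xi1// le_eqVlt; apply/orP; left; apply/eqP.
by field; rewrite gt_eqF.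
Qed.

Lemma Q_lamE s : 0 <= s -> Q s * lam s = E s (fun z => z.1 * z.2).
Proof. by move=> s0; rewrite /Q /cosine_of divfK// gt_eqF// lam_gt0. Qed.

Lemma norm_Q_le1 s : 0 <= s -> `|Q s| <= 1.
Proof.
move=> s0; have l0 := lam_gt0 s0.
rewrite /Q /cosine_of normrM normfV (gtr0_norm l0) ler_pdivrMr//.
apply: le_trans (norm_E_le s0 quadratic_growth_xxi) _.
by apply: (E_norm_xxi_le s0 quadratic_growth_xxi) => // z; rewrite mul1r.
Qed.

Let time : set R := `[0, +oo[%classic.

Lemma measurable_lam : measurable_fun time lam.
Proof.
apply: measurableT_comp.
  by apply: continuous_measurable_fun; exact: sqrt_continuous.
exact: (measurable_path quadratic_growth_x2).
Qed.

Lemma measurable_lamV : measurable_fun time (fun s => (lam s)^-1).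
Proof.
(* The inverse of [lam] is the power [-1/2] of the second moment, and real powers are measurable. *)
rewrite (_ : (fun s => _) = (fun x : R => x `^ (- 2^-1)) \o
    (fun s => E s (fun z => z.1 ^+ 2))).
  apply: measurableT_comp; first exact: measurable_powR.
  exact: (measurable_path quadratic_growth_x2).
apply/funext => s /=; rewrite powRN powR12_sqrt//.
by apply: Rintegral_ge0 => z _; exact: sqr_ge0.
Qed.

Lemma measurable_Q : measurable_fun time Q.
Proof.
apply: measurable_funM; last exact: measurable_lamV.
exact: (measurable_path quadratic_growth_xxi).
Qed.


End paths.

(** * The weak equation for functions of quadratic growth *)

Section weak_equation.
Context {R : realType}.
Variables (omega tau : R) (mu : skorokhod R).
Implicit Types (f g h : R * R -> R) (s t : R).
Hypothesis homega : 0 < omega.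
Hypothesis htau : 0 < tau.
Hypothesis hmu : weak_solution omega tau mu.
Hypothesis hxi : forall t, 0 <= t -> (\int[mu t]_z (z.2 ^+ 2)%:E = 1)%E.

Let E s g := \int[mu s]_z g z.
Let lam s := lambda_of (mu s).
Let Q s := cosine_of (mu s).

(* The right-hand side of the equation for a test function with first two
   x-derivatives g1 and g2. *)
Definition drift_rate g1 s : R :=
  tau * (omega * Q s * E s (fun z => z.2 * g1 z) +
         E s (fun z => z.1 * g1 z) / lam s - E s (fun z => z.1 * g1 z)).

Definition diffusion_rate g2 s : R := diffusionJ omega tau (Q s) * E s g2.

Definition rate g1 g2 s : R := drift_rate g1 s + 2^-1 * diffusion_rate g2 s.

(** The three functions whose integrals make up [rate]. *)
Definition admissible g1 g2 :=
  [/\ quadratic_growth (fun z => z.1 * g1 z),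
      quadratic_growth (fun z => z.2 * g1 z) & quadratic_growth g2].

Lemma measurable_drift_rate g1 : quadratic_growth (fun z => z.1 * g1 z) ->
  quadratic_growth (fun z => z.2 * g1 z) ->
  measurable_fun (`[0, +oo[%classic : set R) (drift_rate g1).
Proof.
move=> q1 q2.
have m1 := measurable_path hmu hxi q1; have m2 := measurable_path hmu hxi q2.
have mQ := measurable_Q hmu hxi; have ml := measurable_lamV hmu hxi.
apply: measurable_funM => //; apply: measurable_funB => //.
apply: measurable_funD; apply: measurable_funM => //.
exact: measurable_funM.
Qed.

Lemma measurable_diffusion_rate g2 : quadratic_growth g2 ->
  measurable_fun (`[0, +oo[%classic : set R) (diffusion_rate g2).
Proof.
move=> q; have mQ := measurable_Q hmu hxi.
apply: measurable_funM; last exact: (measurable_path hmu hxi q).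
apply: measurable_funM => //; apply: measurable_funD => //.
by apply: measurable_funM => //; exact: measurable_funX.
Qed.

Lemma measurable_rate g1 g2 : admissible g1 g2 ->
  measurable_fun (`[0, +oo[%classic : set R) (rate g1 g2).
Proof.
move=> [q1 q2 q3]; apply: measurable_funD; first exact: measurable_drift_rate.
by apply: measurable_funM => //; exact: measurable_diffusion_rate.
Qed.

Lemma diffusionJ_bound s : 0 <= s ->
  0 <= diffusionJ omega tau (Q s) <= tau ^+ 2 * (omega + 1).
Proof.
move=> s0; have := norm_Q_le1 hmu hxi s0; rewrite -/(Q s) => Q1.
have Q2 : Q s ^+ 2 <= 1 by rewrite -(real_normK (num_real _)) exprn_ile1.
rewrite /diffusionJ; apply/andP; split.
  by rewrite mulr_ge0 ?sqr_ge0// addr_ge0// mulr_ge0 ?sqr_ge0// ltW.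
by rewrite ler_wpM2l ?sqr_ge0// lerD2r ler_piMr// ltW.
Qed.

(** The hypothesis [|b| <= B lam] replaces a lower bound on [lam] in the singular term. The constant
    [omega + 2] adds up [omega] for the term in [Q], where [|Q| <= 1], and [1] for each of the terms
    in [b]. *)
Lemma norm_drift_le s (a b B : R) : 0 <= s -> `|a| <= B -> `|b| <= B ->
  `|b| <= B * lam s -> `|tau * (omega * Q s * a + b / lam s - b)| <=
  tau * (omega + 2) * B.
Proof.
move=> s0 aB bB bl; have Q1 : `|Q s| <= 1 := norm_Q_le1 hmu hxi s0.
have l0 := lam_gt0 hmu s0.
rewrite normrM (gtr0_norm htau) -[leRHS]mulrA ler_wpM2l ?(ltW htau)//.
rewrite (_ : (omega + 2) * B = omega * B + B + B); last by ring.
rewrite (le_trans (ler_normB _ _))// lerD// (le_trans (ler_normD _ _))// lerD//.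
  rewrite -mulrA normrM (gtr0_norm homega) ler_wpM2l ?(ltW homega)// normrM.
  by apply: le_trans (ler_wpM2r (normr_ge0 a) Q1) _; rewrite mul1r.
by rewrite normrM normfV (gtr0_norm l0) ler_pdivrMr.
Qed.

(** The third bound, proportional to [lam s], is the one that tames the division by [lambda].
    Absolute values stand inside the integrals because the weak equation requires absolute
    convergence. *)
Definition moment_bounds g1 g2 (B : R) s :=
  [/\ E s (fun z => `|z.2 * g1 z|) <= B, E s (fun z => `|z.1 * g1 z|) <= B,
      E s (fun z => `|z.1 * g1 z|) <= B * lam s & E s (fun z => `|g2 z|) <= B].

Lemma norm_drift_rate_le g1 g2 B s : 0 <= s -> admissible g1 g2 ->
  moment_bounds g1 g2 B s -> `|drift_rate g1 s| <= tau * (omega + 2) * B.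
Proof.
move=> s0 [q1 q2 q3] [b2 b1 bl b3].
apply: norm_drift_le => //.
- exact: le_trans (norm_E_le hmu hxi s0 q2) b2.
- exact: le_trans (norm_E_le hmu hxi s0 q1) b1.
- exact: le_trans (norm_E_le hmu hxi s0 q1) bl.
Qed.

Lemma norm_diffusion_rate_le g1 g2 B s : 0 <= s -> admissible g1 g2 ->
  moment_bounds g1 g2 B s ->
  `|diffusion_rate g2 s| <= tau ^+ 2 * (omega + 1) * B.
Proof.
move=> s0 [q1 q2 q3] [b2 b1 bl b3].
have /andP[J0 J1] := diffusionJ_bound s0.
rewrite normrM (ger0_norm J0) ler_pM//.
exact: le_trans (norm_E_le hmu hxi s0 q3) b3.
Qed.

Lemma norm_rate_le g1 g2 B s : 0 <= s -> admissible g1 g2 ->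
  moment_bounds g1 g2 B s ->
  `|rate g1 g2 s| <= (tau * (omega + 2) + tau ^+ 2 * (omega + 1)) * B.
Proof.
move=> s0 ad mb; have B0 : 0 <= B.
  by have [_ + _ _] := mb; apply: le_trans; apply: Rintegral_ge0.
rewrite mulrDl (le_trans (ler_normD _ _))// lerD//.
  exact: norm_drift_rate_le ad mb.
rewrite normrM (le_trans _ (norm_diffusion_rate_le s0 ad mb))//.
by rewrite ler_piMl// ger0_norm// invf_le1// ler1n.
Qed.

Lemma quadratic_growth_norm g :
  quadratic_growth g -> quadratic_growth (fun z => `|g z|).
Proof.
move=> [cg mg [a ga]]; split.
- by move=> z; apply: cvg_norm; exact: cg.
- exact: measurableT_comp.
- by exists a => z; rewrite normr_id.
Qed.

Lemma measurable_itv_time t (k : R -> R) :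
  measurable_fun (`[0, +oo[%classic : set R) k -> measurable_fun `[0, t] k.
Proof.
apply: measurable_funS => // s /=.
by rewrite !in_itv/= andbT => /andP[].
Qed.

(** Bounds uniform on [[0, t]] give both absolute convergence conditions, as well as integrability
    in time of the two rates, so that the two time integrals merge into one. *)
Lemma weak_equation f g1 g2 (B t : R) : 0 <= t ->
  (forall z, 0 < f z) -> (exists B : R, forall z, f z <= B) -> class_C 3 f ->
  d_x f = g1 -> d_x g1 = g2 -> admissible g1 g2 ->
  (forall s, 0 <= s <= t -> moment_bounds g1 g2 B s) ->
  E t f - E 0 f = \int[lebesgue_measure]_(s in `[0, t]) rate g1 g2 s.
Proof.
move=> t0 f0 fB fC fg1 gg2 ad mb; have [q1 q2 q3] := ad.
have driftE s z : drift_term omega tau f (mu s) z =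
    (tau * (omega * Q s)) * (z.2 * g1 z) + (tau * ((lam s)^-1 - 1)) * (z.1 * g1 z).
  by rewrite /drift_term /driftG fg1 -/(Q s) -/(lam s); ring.
have diffE s z : diffusion_term omega tau f (mu s) z =
    diffusionJ omega tau (Q s) * g2 z by rewrite /diffusion_term fg1 gg2.
have drift_rateE s : 0 <= s ->
    \int[mu s]_z drift_term omega tau f (mu s) z = drift_rate g1 s.
  move=> s0; under eq_Rintegral do rewrite driftE.
  by rewrite (E_linear2 hmu hxi _ _ s0 q2 q1) /drift_rate /E; ring.
have diff_rateE s : 0 <= s ->
    \int[mu s]_z diffusion_term omega tau f (mu s) z = diffusion_rate g2 s.
  move=> s0; under eq_Rintegral do rewrite diffE.
  by rewrite RintegralZl//; exact: (quadratic_integrable hmu hxi s0 q3).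
(* Comparison with a constant through [le_integral_nonmeasurable] avoids any measurability in time
   of the inner integral, whose integrand itself varies with [s]. *)
have finite (k : R -> R * R -> R) (K : R) :
    (forall s, 0 <= s <= t -> quadratic_growth (k s)) ->
    (forall s, 0 <= s <= t -> E s (fun z => `|k s z|) <= K) ->
    (\int[lebesgue_measure]_(s in `[0%R, t]) \int[mu s]_z `|k s z|%:E < +oo)%E.
  move=> qk kK; apply: (@le_lt_trans _ _ (\int[lebesgue_measure]_(s in `[0%R, t]) K%:E)%E).
    apply: le_integral_nonmeasurable => s; rewrite /= in_itv/= => /[dup] st /andP[s0 _].
      by apply: integral_ge0.
    rewrite -[leLHS]fineK; first by rewrite lee_fin; exact: kK.
    apply: (integrable_fin_num measurableT).
    exact: (integrable_norm (quadratic_integrable hmu hxi s0 (qk s st))).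
  rewrite integral_cst//= lebesgue_measure_itv; case: ifP => _ /=.
    by rewrite ltry.
  by rewrite mule0 ltry.
have E0 s g : 0 <= E s (fun z => `|g z|) by apply: Rintegral_ge0.
have qdrift s : quadratic_growth (drift_term omega tau f (mu s)).
  rewrite (funext (driftE s)); exact: quadratic_growth_lin2.
have qdiff s : quadratic_growth (diffusion_term omega tau f (mu s)).
  rewrite (_ : diffusion_term _ _ _ _ =
    fun z => diffusionJ omega tau (Q s) * g2 z + 0 * g2 z).
    exact: quadratic_growth_lin2.
  by apply/funext => z; rewrite diffE mul0r addr0.
have fin1 := finite (fun s => drift_term omega tau f (mu s))
  (tau * (omega + 2) * B) (fun s _ => qdrift s).
have fin2 := finite (fun s => diffusion_term omega tau f (mu s))
  (tau ^+ 2 * (omega + 1) * B) (fun s _ => qdiff s).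
rewrite (hmu.2 f f0 fB fC t t0); first last.
- apply: fin2 => s st; have [s0 _] := andP st; have [b2 b1 bl b3] := mb s st.
  have /andP[J0 J1] := diffusionJ_bound s0.
  rewrite /E; under eq_Rintegral do rewrite diffE normrM (ger0_norm J0).
  rewrite RintegralZl//; first by rewrite ler_pM// E0.
  exact: (integrable_norm (quadratic_integrable hmu hxi s0 q3)).
- apply: fin1 => s st; have [s0 _] := andP st; have [b2 b1 bl b3] := mb s st.
  have l0 := lam_gt0 hmu s0.
  have n1 := quadratic_growth_norm q1; have n2 := quadratic_growth_norm q2.
  (* The coefficients come from [|Q| <= 1] and [|1 / lam - 1| <= 1 / lam + 1]; the part in [1 / lam]
     is absorbed by the moment bound proportional to [lam]. *)
  apply: le_trans (E_normed_le hmu hxi s0 (qdrift s) (quadratic_growth_lin2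
    (tau * omega) (tau * ((lam s)^-1 + 1)) n2 n1) _) _.
    move=> z; rewrite driftE (le_trans (ler_normD _ _))// lerD//.
      rewrite normrM ler_wpM2r// mulrA normrM gtr0_norm ?mulr_gt0//.
      rewrite ler_piMr ?mulr_ge0 ?(ltW htau) ?(ltW homega)//.
      exact: (norm_Q_le1 hmu hxi s0).
    rewrite normrM ler_wpM2r// normrM (gtr0_norm htau) ler_pM2l//.
    by rewrite (le_trans (ler_normB _ _))// normr1 gtr0_norm ?invr_gt0.
  rewrite (E_linear2 hmu hxi _ _ s0 n2 n1) -!mulrA -mulrDr ler_pM2l//.
  rewrite (_ : (omega + 2) * B = omega * B + (B + B)); last by ring.
  rewrite lerD//; first by rewrite ler_pM2l.
  by rewrite mulrDl mul1r lerD// mulrC ler_pdivrMr.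
have idrift : lebesgue_measure.-integrable `[0, t] (EFin \o drift_rate g1).
  apply: (@bounded_itv_integrable _ _ _ _ (tau * (omega + 2) * B)).
    by apply: measurable_itv_time; exact: measurable_drift_rate.
  by move=> s /[dup] st /andP[s0 _]; exact: norm_drift_rate_le ad (mb s st).
have idiff : lebesgue_measure.-integrable `[0, t] (EFin \o diffusion_rate g2).
  apply: (@bounded_itv_integrable _ _ _ _ (tau ^+ 2 * (omega + 1) * B)).
    by apply: measurable_itv_time; exact: measurable_diffusion_rate.
  by move=> s /[dup] st /andP[s0 _]; exact: norm_diffusion_rate_le ad (mb s st).
transitivity (\int[lebesgue_measure]_(s in `[0, t])
  (1 * drift_rate g1 s + 2^-1 * diffusion_rate g2 s)).
  rewrite Rintegral_linear2// mul1r; congr (_ + _ * _); apply: eq_Rintegral => s;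
    rewrite inE /= in_itv/= => /andP[s0 _]; [exact: drift_rateE|exact: diff_rateE].
by apply: eq_Rintegral => s _; rewrite mul1r.
Qed.

End weak_equation.

(** * Derivatives of the truncations of x^2 and x, and bounds for the truncated square *)

Section test_functions.
Context {R : realType}.
Implicit Types (e x : R).

Lemma deriv_den e : (den e)^`() = (2 * e ^+ 2)%:P * 'X :> {poly R}.
Proof.
rewrite /den derivD -[1]/(1%:P) derivC add0r derivZ derivXn -mul_polyC /=.
ring.
Qed.

Lemma rat_deriv_sqr e : rat_deriv e 'X^2 1 = 2%:P * 'X :> {poly R}.
Proof. rewrite /rat_deriv deriv_den derivXn /den -!mul_polyC /=; ring. Qed.

Lemma rat_deriv_sqr2 e :
  rat_deriv e (2%:P * 'X) 2 = 2%:P - (6 * e ^+ 2)%:P * 'X^2 :> {poly R}.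
Proof.
rewrite /rat_deriv deriv_den derivM derivC derivX /den -!mul_polyC /=; ring.
Qed.

Lemma rat_deriv_id e :
  rat_deriv e 'X 1 = 1 - (e ^+ 2)%:P * 'X^2 :> {poly R}.
Proof. rewrite /rat_deriv deriv_den derivX /den -!mul_polyC /=; ring. Qed.

Lemma rat_deriv_id2 e :
  rat_deriv e (1 - (e ^+ 2)%:P * 'X^2) 2 =
  (2 * e ^+ 4)%:P * 'X^3 - (6 * e ^+ 2)%:P * 'X :> {poly R}.
Proof.
rewrite /rat_deriv deriv_den derivB derivM derivC derivXn /den -!mul_polyC.
rewrite -[1]/(1%:P) derivC /=; ring.
Qed.

Lemma den_ge1 e x : 1 <= (den e).[x].
Proof. by rewrite denE lerDl sqr_ge0. Qed.

Lemma norm_div_exp (u d : R) (b : nat) : 1 <= d -> `|u / d ^+ b| <= `|u|.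
Proof.
move=> d1; have db : 1 <= d ^+ b by exact: exprn_ege1.
have db0 : 0 < d ^+ b by exact: lt_le_trans db.
rewrite normrM normfV (gtr0_norm db0) ler_pdivrMr//.
by rewrite ler_peMr.
Qed.

Lemma norm_rat_le e p b x : `|rat e p b x| <= `|p.[x]|.
Proof. exact/norm_div_exp/den_ge1. Qed.

(** For [f = x^2 / d] one has [x f' = 2 f / d] with [d >= 1]. The sign allows the restoring term of
    the drift to be dropped; the upper bound closes the estimate on the truncated moment. *)
Lemma x_rat_sqr' e x : 0 <= x * rat e (2%:P * 'X) 2 x <= 2 * rat e 'X^2 1 x.
Proof.
rewrite /rat hornerM hornerC hornerX hornerXn expr1.
have d1 := den_ge1 e x; have d0 := den_gt0 e x; move: (den e).[x] d1 d0 => d d1 d0.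
rewrite (_ : x * (2 * x / d ^+ 2) = 2 * (x ^+ 2 / d) * d^-1); last by field; rewrite gt_eqF.
have h : 0 <= 2 * (x ^+ 2 / d) by rewrite mulr_ge0// divr_ge0 ?sqr_ge0// ltW.
rewrite mulr_ge0 ?invr_ge0 ?(ltW d0)//=.
by rewrite ler_piMr// invf_le1.
Qed.

Lemma xi_rat_sqr'_le e x y : `|y * rat e (2%:P * 'X) 2 x| <= 2 * `|x * y|.
Proof.
rewrite normrM (mulrC x) (normrM y x) [leRHS]mulrCA ler_wpM2l//.
apply: le_trans (norm_rat_le _ _ _ _) _.
by rewrite hornerM hornerC hornerX normrM ger0_norm.
Qed.

(** The derivative is [2 w] with [w = x / d^2], and [w^2 <= x^2 / d], so Young's inequality yields
    the truncated square rather than [x^2]. The weight [a] is free, to be taken small on long time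
    intervals. *)
Lemma xi_rat_sqr'_AMGM e x y (a : R) : 0 < a ->
  `|y * rat e (2%:P * 'X) 2 x| <= a * rat e 'X^2 1 x + a^-1 * y ^+ 2.
Proof.
move=> a0; rewrite /rat hornerM hornerC hornerX hornerXn expr1.
have d1 := den_ge1 e x; have d0 := den_gt0 e x; move: (den e).[x] d1 d0 => d d1 d0.
pose w := x / d ^+ 2.
have wx : w ^+ 2 <= x ^+ 2 / d.
  rewrite /w exprMn ler_wpM2l ?sqr_ge0// exprVn -exprM lef_pV2 ?posrE ?exprn_gt0//.
  by rewrite -[leLHS]expr1 ler_weXn2l.
apply: (@le_trans _ _ (a * w ^+ 2 + a^-1 * y ^+ 2)); last first.
  by rewrite lerD2r ler_wpM2l// ltW.
rewrite (_ : y * (2 * x / d ^+ 2) = 2 * (y * w)); last by rewrite /w; ring.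
rewrite ler_norml; apply/andP; split; rewrite -subr_ge0.
  rewrite (_ : _ - _ = a * (w + a^-1 * y) ^+ 2); last by field; rewrite gt_eqF.
  by rewrite mulr_ge0 ?sqr_ge0// ltW.
rewrite (_ : _ - _ = a * (w - a^-1 * y) ^+ 2); last by field; rewrite gt_eqF.
by rewrite mulr_ge0 ?sqr_ge0// ltW.
Qed.

Lemma rat_sqr''_le e x :
  `|rat e (2%:P - (6 * e ^+ 2)%:P * 'X^2) 3 x| <= 6.
Proof.
rewrite /rat (_ : _.[x] = 2 - 6 * (e * x) ^+ 2); last first.
  by rewrite hornerD hornerN hornerM !hornerC hornerXn; ring.
rewrite denE.
have d1 := den_ge1 e x; rewrite denE in d1.
have d0 := den_gt0 e x; rewrite denE in d0.
rewrite normrM normfV (gtr0_norm (exprn_gt0 3 d0)) ler_pdivrMr ?exprn_gt0//.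
apply: (@le_trans _ _ (6 * (1 + (e * x) ^+ 2))); last first.
  by rewrite ler_wpM2l// -[leLHS]expr1 ler_weXn2l.
have h := sqr_ge0 (e * x); rewrite ler_norml; apply/andP; split; lra.
Qed.

End test_functions.

Lemma eq_quadratic_growth (R : realType) (g h : R * R -> R) :
  (forall z, g z = h z) -> quadratic_growth g -> quadratic_growth h.
Proof. by move=> /funext ->. Qed.

(** * Local boundedness of the second moment *)

Section second_moment_bound.
Context {R : realType}.

Lemma quadratic_growth_rat_sqr e :
  quadratic_growth (fun z : R * R => rat e 'X^2 1 z.1).
Proof.
apply: (@eq_quadratic_growth _ (fun z => rat e 'X^2 1 z.1 * 1)) => [z|].
  by rewrite mulr1.
apply: (@quadratic_growth_separated _ (rat e 'X^2 1) (fun=> 1) 1).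
- exact: rat_continuous.
- by move=> x; exact: cvg_cst.
- move=> x y; rewrite mulr1 mul1r ger0_norm ?rat_sqr_ge0//.
  have := rat_sqr_le e x; have := sqr_ge0 y; lra.
Qed.

Lemma admissible_sqr e : admissible
  (fun z : R * R => rat e (2%:P * 'X) 2 z.1)
  (fun z => rat e (2%:P - (6 * e ^+ 2)%:P * 'X^2) 3 z.1).
Proof.
split.
- apply: (@eq_quadratic_growth _ (fun z => z.1 * rat e (2%:P * 'X) 2 z.1 * 1)) => [z|].
    by rewrite mulr1.
  apply: (@quadratic_growth_separated _ (fun x => x * rat e (2%:P * 'X) 2 x) (fun=> 1) 2).
  + by move=> x; apply: cvgM; [exact: cvg_id|exact: rat_continuous].
  + by move=> x; exact: cvg_cst.
  + move=> x y; have /andP[h0 h1] := x_rat_sqr' e x.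
    rewrite mulr1 ger0_norm//.
    have := rat_sqr_le e x; have := sqr_ge0 y; lra.
- apply: (@eq_quadratic_growth _ (fun z => rat e (2%:P * 'X) 2 z.1 * z.2)) => [z|].
    by rewrite mulrC.
  apply: (@quadratic_growth_separated _ (rat e (2%:P * 'X) 2) id 2).
  + exact: rat_continuous.
  + by move=> x; exact: cvg_id.
  + move=> x y; rewrite mulrC (le_trans (xi_rat_sqr'_le _ _ _))//.
    by have := normM_le_quad x y; lra.
- apply: (@eq_quadratic_growth _
      (fun z => rat e (2%:P - (6 * e ^+ 2)%:P * 'X^2) 3 z.1 * 1)) => [z|].
    by rewrite mulr1.
  apply: (@quadratic_growth_separated _ _ (fun=> 1) 6).
  + exact: rat_continuous.
  + by move=> x; exact: cvg_cst.
  + move=> x y; rewrite mulr1 (le_trans (rat_sqr''_le _ _))//.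
    have := sqr_ge0 x; have := sqr_ge0 y; lra.
Qed.

(** Taking for [M] the supremum [S] of [u] gives [S <= A + S / 2]. The bound [B] makes [S] finite
    and then disappears from the conclusion, which is what removes the dependence on the
    truncation. *)
Lemma halving_bound (T : Type) (D : set T) (u : T -> R) (A B : R) :
  (forall s, D s -> 0 <= u s <= B) ->
  (forall M, (forall s, D s -> u s <= M) -> forall s, D s -> u s <= A + M / 2) ->
  forall s, D s -> u s <= 2 * A.
Proof.
move=> uB h s Ds.
have hs : has_sup [set u r | r in D].
  by split; [exists (u s), s|exists B => _ [r Dr <-]; have /andP[] := uB r Dr].
have us r : D r -> u r <= sup [set u r | r in D].
  by move=> Dr; apply: ub_le_sup; [exact: hs.2|exists r].
have : sup [set u r | r in D] <= A + sup [set u r | r in D] / 2.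
  by apply: ge_sup; [exact: hs.1|move=> _ [r Dr <-]; exact: h].
by have := us s Ds; lra.
Qed.

Variables (omega tau : R) (mu : skorokhod R).
Implicit Types (s t : R).
Hypothesis homega : 0 < omega.
Hypothesis htau : 0 < tau.
Hypothesis hmu : weak_solution omega tau mu.
Hypothesis hxi : forall t, 0 <= t -> (\int[mu t]_z (z.2 ^+ 2)%:E = 1)%E.

Let E s g := \int[mu s]_z g z.
Let lam s := lambda_of (mu s).
Let Q s := cosine_of (mu s).

Lemma E_le s g h : 0 <= s -> quadratic_growth g -> quadratic_growth h ->
  (forall z, g z <= h z) -> E s g <= E s h.
Proof.
by move=> s0 qg qh gh; apply: le_Rintegral => //; exact: (quadratic_integrable hmu hxi s0).
Qed.

(** Under probability measures the constant [C] cancels in the increment, so a bounded test function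
    can be made positive at no cost. *)
Lemma weak_equation_shift (C : R) (f g1 g2 : R * R -> R) (B t : R) :
  quadratic_growth f -> (forall z, 0 < C + f z) ->
  (exists B : R, forall z, C + f z <= B) -> class_C 3 (fun z => C + f z) ->
  d_x (fun z => C + f z) = g1 -> d_x g1 = g2 -> admissible g1 g2 ->
  (forall s, 0 <= s <= t -> moment_bounds mu g1 g2 B s) -> 0 <= t ->
  E t f - E 0 f = \int[lebesgue_measure]_(s in `[0, t]) rate omega tau mu g1 g2 s.
Proof.
move=> qf f0 fB fC fg1 gg2 ad mb t0.
rewrite -(weak_equation homega htau hmu hxi t0 f0 fB fC fg1 gg2 ad mb).
have Ef s : 0 <= s -> \int[mu s]_z (C + f z) = C + E s f.
  move=> s0; rewrite RintegralD ?Rintegral_prob_cst//.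
  - exact: finite_measure_integrable_cst.
  - exact: (quadratic_integrable hmu hxi s0 qf).
by rewrite !Ef// opprD addrACA subrr add0r.
Qed.

Lemma Rintegral_itv_le (h : R -> R) (t B c : R) : 0 <= t ->
  measurable_fun `[0, t] h -> (forall s, 0 <= s <= t -> `|h s| <= B) ->
  (forall s, 0 <= s <= t -> h s <= c) ->
  \int[lebesgue_measure]_(s in `[0, t]) h s <= c * t.
Proof.
move=> t0 mh hB hc.
apply: (@le_trans _ _ (\int[lebesgue_measure]_(s in `[0, t]) c)).
  apply: le_Rintegral => //; first exact: bounded_itv_integrable mh hB.
  exact: (@bounded_itv_integrable _ _ _ _ `|c|).
rewrite Rintegral_cst//= lebesgue_measure_itv/= lte_fin.
case: ltP => [_|t0'] /=; first by rewrite subr0.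
by rewrite mulr0 (_ : t = 0) ?mulr0//; apply/eqP; rewrite eq_le t0' t0.
Qed.

Section truncated.
Variable n : nat.
Let e : R := eps n.
Let U s := E s (fun z => rat e 'X^2 1 z.1).
Let g1 (z : R * R) := rat e (2%:P * 'X) 2 z.1.
Let g2 (z : R * R) := rat e (2%:P - (6 * e ^+ 2)%:P * 'X^2) 3 z.1.
Let qU := quadratic_growth_rat_sqr e.

Lemma truncated_sqr_bounds s : 0 <= s -> [/\ 0 <= U s, U s <= e ^- 2 & U s <= lam s ^+ 2].
Proof.
move=> s0; split.
- by apply: Rintegral_ge0 => z _; exact: rat_sqr_ge0.
- rewrite -(Rintegral_prob_cst (mu s) (e ^- 2)); apply: le_Rintegral => //.
  + exact: (quadratic_integrable hmu hxi s0).
  + exact: finite_measure_integrable_cst.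
  + by move=> z _; apply: rat_sqr_bounded; exact: eps_gt0.
- rewrite (sqr_lam mu); apply: E_le => //; first exact: quadratic_growth_x2.
  by move=> z; exact: rat_sqr_le.
Qed.

Lemma E_x_sqr'_le s : 0 <= s ->
  E s (fun z => `|z.1 * g1 z|) <= 2 * U s.
Proof.
move=> s0; have [q1 q2 q3] := admissible_sqr e.
have := E_normed_le hmu hxi s0 q1 (quadratic_growth_lin2 2 0 qU qU).
rewrite (E_linear2 hmu hxi _ _ s0 qU qU) mul0r addr0; apply => z.
by have /andP[h0 h1] := x_rat_sqr' e z.1; rewrite ger0_norm// mul0r addr0.
Qed.

Lemma E_xi_sqr'_le s (a : R) : 0 <= s -> 0 < a ->
  E s (fun z => `|z.2 * g1 z|) <= a * U s + a^-1.
Proof.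
move=> s0 a0; have [q1 q2 q3] := admissible_sqr e.
have := E_normed_le hmu hxi s0 q2
  (quadratic_growth_lin2 a a^-1 qU (@quadratic_growth_xi2 R)).
rewrite (E_linear2 hmu hxi _ _ s0 qU (@quadratic_growth_xi2 R)).
rewrite (second_moment_xi1 hxi s0) mulr1; apply => z.
exact: xi_rat_sqr'_AMGM.
Qed.

Lemma E_sqr''_le s : 0 <= s -> E s (fun z => `|g2 z|) <= 6.
Proof.
move=> s0; have [q1 q2 q3] := admissible_sqr e.
rewrite -(Rintegral_prob_cst (mu s) 6); apply: le_Rintegral => //.
- exact: (integrable_norm (quadratic_integrable hmu hxi s0 q3)).
- exact: finite_measure_integrable_cst.
- by move=> z _; exact: rat_sqr''_le.
Qed.

(** If [lam >= 1 / a], the quotient is at most [a U]. Otherwise [U <= lam^2] bounds it by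
    [lam < 1 / a]: a small [lam] forces a small [U]. *)
Lemma truncated_div_lam_le s (a : R) : 0 <= s -> 0 < a ->
  U s / lam s <= a * U s + a^-1.
Proof.
move=> s0 a0; have [U0 U1 U2] := truncated_sqr_bounds s0.
have l0 : 0 < lam s := lam_gt0 hmu s0.
have ai : 0 < a^-1 by rewrite invr_gt0.
have [al|al] := leP a^-1 (lam s).
  apply: (@le_trans _ _ (a * U s)); last by rewrite lerDl ltW.
  rewrite mulrC ler_wpM2r// -[leRHS]invrK lef_pV2 ?posrE//.
apply: (@le_trans _ _ a^-1); last by rewrite lerDr mulr_ge0// ltW.
rewrite ler_pdivrMr// (le_trans U2)// expr2 ler_wpM2r//; exact: ltW.
Qed.

(** A bound that blows up as the truncation is removed, meant only to give access to the weak
    equation. It is the case [a = 1] of the previous estimates, with [U <= e^-2], and [6] for the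
    second derivative. *)
Lemma truncated_moment_bounds s : 0 <= s ->
  moment_bounds mu g1 g2 (2 * (e ^- 2 + 1) + 6) s.
Proof.
move=> s0; have [U0 U1 U2] := truncated_sqr_bounds s0.
have l0 : 0 < lam s := lam_gt0 hmu s0.
have e0 : 0 <= e ^- 2 by rewrite invr_ge0 sqr_ge0.
have hx := E_x_sqr'_le s0; split.
- by have := E_xi_sqr'_le s0 ltr01; rewrite invr1 mul1r /E; lra.
- by move: hx; rewrite /E; lra.
- have := truncated_div_lam_le s0 ltr01.
  rewrite invr1 mul1r ler_pdivrMr// => h.
  apply: le_trans hx _; rewrite -/(lam s).
  apply: (@le_trans _ _ (2 * ((U s + 1) * lam s))); first by rewrite ler_wpM2l.
  rewrite mulrA ler_wpM2r// ?(ltW l0)//; lra.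
- by have := E_sqr''_le s0; rewrite /E; lra.
Qed.

Lemma truncated_equation t : 0 <= t ->
  U t - U 0 = \int[lebesgue_measure]_(s in `[0, t]) rate omega tau mu g1 g2 s.
Proof.
move=> t0; have e0 : 0 < e := eps_gt0 n.
have fE : (fun z => 1 + rat e 'X^2 1 z.1) = rat2 e 1 'X^2 1 1 0.
  by apply/funext => z; rewrite /rat2 rat_1p mulr1.
apply: (@weak_equation_shift 1 _ g1 g2 (2 * (e ^- 2 + 1) + 6)).
- exact: quadratic_growth_rat_sqr.
- by move=> z; rewrite ltr_pwDl// rat_sqr_ge0.
- by exists (1 + e ^- 2) => z; rewrite lerD2l rat_sqr_bounded.
- by rewrite fE; exact: class_C_rat2.
- rewrite fE d_x_rat2 rat_deriv_sqr; apply/funext => z.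
  by rewrite /rat2 rat_1p mulr1 add0r.
- rewrite (_ : g1 = rat2 e 0 (2%:P * 'X) 2 1 0).
    rewrite d_x_rat2 rat_deriv_sqr2; apply/funext => z.
    by rewrite /rat2 rat_1p mulr1 add0r.
  by apply/funext => z; rewrite /rat2 rat_1p mulr1 add0r.
- exact: admissible_sqr.
- by move=> s /andP[s0 _]; exact: truncated_moment_bounds.
- exact: t0.
Qed.

(** Only an upper bound is sought, so the nonpositive term [- E(x g1)] is dropped. The [xi] term
    contributes [omega], the singular term [2] because [x f' <= 2 f], and [3] is half of the bound
    [6] on the second derivative. *)
Lemma truncated_rate_le s (a M : R) : 0 <= s -> 0 < a -> U s <= M ->
  rate omega tau mu g1 g2 s <=
  tau * (omega + 2) * (a * M + a^-1) + 3 * (tau ^+ 2 * (omega + 1)).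
Proof.
move=> s0 a0 UM; have [q1 q2 q3] := admissible_sqr e.
have l0 : 0 < lam s := lam_gt0 hmu s0.
have UaM : a * U s + a^-1 <= a * M + a^-1 by rewrite lerD2r ler_pM2l.
apply: lerD.
  rewrite /drift_rate -[leRHS]mulrA ler_pM2l// [leRHS]mulrDl -[leLHS]addrA lerD//.
    rewrite -[leLHS]mulrA ler_pM2l// (le_trans (ler_norm _))// normrM.
    apply: le_trans (ler_wpM2r (normr_ge0 _) (norm_Q_le1 hmu hxi s0)) _.
    rewrite mul1r (le_trans (norm_E_le hmu hxi s0 q2))//.
    exact: le_trans (E_xi_sqr'_le s0 a0) UaM.
  apply: (@le_trans _ _ ((\int[mu s]_z (z.1 * g1 z)) / lambda_of (mu s))).
    rewrite gerBl; apply: Rintegral_ge0 => z _.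
    by have /andP[] := x_rat_sqr' e z.1.
  apply: (@le_trans _ _ (2 * (U s / lam s))).
    rewrite mulrA ler_wpM2r ?invr_ge0 ?(ltW l0)//.
    apply: le_trans (E_x_sqr'_le s0).
    exact: le_trans (ler_norm _) (norm_E_le hmu hxi s0 q1).
  rewrite ler_pM2l// (le_trans (truncated_div_lam_le s0 a0))//.
rewrite (_ : 3 * _ = 2^-1 * (tau ^+ 2 * (omega + 1) * 6)); last by field.
rewrite ler_pM2l ?invr_gt0//.
have /andP[J0 J1] := diffusionJ_bound homega hmu hxi s0.
apply: le_trans (ler_norm _) _; rewrite normrM (ger0_norm J0) ler_pM//.
exact: le_trans (norm_E_le hmu hxi s0 q3) (E_sqr''_le s0).
Qed.

(* For small [a], an a priori bound on the truncated moment improves itself, so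
   that it can be taken independent of the truncation. *)
Lemma truncated_sqr_le (T a : R) : 0 <= T -> 0 < a ->
  T * (tau * (omega + 2) * a) <= 2^-1 -> forall s, 0 <= s <= T ->
  U s <= 2 * (lam 0 ^+ 2 +
    T * (tau * (omega + 2) * a^-1 + 3 * (tau ^+ 2 * (omega + 1)))).
Proof.
move=> T0 a0 Ta.
apply: (@halving_bound _ [set s | 0 <= s <= T] U _ (e ^- 2)).
  by move=> s /andP[s0 _]; have [-> ->] := truncated_sqr_bounds s0.
move=> M UM t /= /[dup] tT /andP[t0 tT'].
have M0 : 0 <= M.
  by have [U0 _ _] := truncated_sqr_bounds t0; exact: le_trans (UM t tT).
have [_ _ U0L] := truncated_sqr_bounds (lexx 0).
set c := tau * (omega + 2) * (a * M + a^-1) + 3 * (tau ^+ 2 * (omega + 1)).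
have c0 : 0 <= c.
  rewrite addr_ge0 ?mulr_ge0 ?sqr_ge0 ?addr_ge0 ?mulr_ge0 ?invr_ge0 ?(ltW homega)
    ?(ltW htau) ?(ltW a0)//.
have : U t - U 0 <= c * t.
  rewrite truncated_equation//; apply: Rintegral_itv_le => //.
  - by apply: measurable_itv_time; apply: measurable_rate => //; exact: admissible_sqr.
  - move=> s /andP[s0 _].
    exact: (norm_rate_le homega htau hmu hxi s0 (admissible_sqr e)
      (truncated_moment_bounds s0)).
  - move=> s /andP[s0 st]; apply: truncated_rate_le => //.
    by apply: UM; rewrite /= s0 (le_trans st).
have : c * t <= c * T by rewrite ler_wpM2l.
(* The coefficient of [M] is the quantity assumed to be at most [1/2]. *)
have -> : c * T = T * (tau * (omega + 2) * a) * M +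
    T * (tau * (omega + 2) * a^-1 + 3 * (tau ^+ 2 * (omega + 1))).
  by rewrite /c; ring.
have : T * (tau * (omega + 2) * a) * M <= 2^-1 * M by rewrite ler_wpM2r.
lra.
Qed.

End truncated.

Lemma second_moment_bounded (T : R) : 0 <= T ->
  exists K : R, forall s, 0 <= s <= T -> lam s ^+ 2 <= K.
Proof.
(* With this [a] the coefficient to be kept below [1/2] equals [T / (2 (T + 1))]; [T + 1] also
   covers [T = 0]. *)
move=> T0; pose a := (2 * (T + 1) * (tau * (omega + 2)))^-1.
have w0 : 0 < tau * (omega + 2) by rewrite mulr_gt0// addr_gt0.
have T1 : 0 < T + 1 by rewrite ltr_wpDl.
have a0 : 0 < a by rewrite invr_gt0 (mulr_gt0 _ w0)// mulr_gt0.
have Ta : T * (tau * (omega + 2) * a) <= 2^-1.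
  rewrite (_ : _ * _ = 2^-1 * (T / (T + 1))).
    by rewrite ler_piMr// ler_pdivrMr// mul1r lerDl.
  by rewrite /a; field; rewrite !gt_eqF// addr_gt0.
(* The bound left open is the one of [truncated_sqr_le], the same for all [n], so it survives the
   limit. *)
eexists => s sT; have /andP[s0 _] := sT.
have : E s (fun z => rat (eps n) 'X^2 1 z.1) @[n --> \oo] --> lam s ^+ 2.
  rewrite (sqr_lam mu); apply: (@Rintegral_dominated_cvg _ _ _ (mu s) setT
    (fun n z => rat (eps n) 'X^2 1 z.1) _ (fun z => z.1 ^+ 2)) => //.
  - by move=> n; have [] := quadratic_growth_rat_sqr (eps n : R).
  - move=> z _; have <- : 'X^2.[z.1 : R] = z.1 ^+ 2 by rewrite hornerXn.
    exact: rat_cvg.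
  - exact: (integrable_x2 hmu s0).
  - by move=> n z _; rewrite ger0_norm ?rat_sqr_ge0// rat_sqr_le.
move=> /ler_cvg_to/(_ (cvg_cst _)); apply; apply: nearW => n.
exact: (truncated_sqr_le n T0 a0 Ta sT).
Qed.

End second_moment_bound.

(** * Test functions for the cross moment, and pointwise limits of all truncations *)

Section cross_moment_test_function.
Context {R : realType}.
Implicit Types (e x y : R).

Lemma rat_id_le e x : 0 < e -> `|rat e 'X 1 x| <= (2 * e)^-1.
Proof.
move=> e0; have d0 := den_gt0 e x.
rewrite /rat hornerX expr1 normrM normfV (gtr0_norm d0) ler_pdivrMr//.
rewrite mulrC ler_pdivlMr ?mulr_gt0// denE -subr_ge0.
rewrite (_ : _ - _ = (1 - e * `|x|) ^+ 2) ?sqr_ge0//.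
by rewrite -(real_normK (num_real (e * x))) normrM (gtr0_norm e0); ring.
Qed.

Lemma norm_rat_id_le e x : `|rat e 'X 1 x| <= `|x|.
Proof. by rewrite (le_trans (norm_rat_le _ _ _ _))// hornerX. Qed.

Lemma rat_id'_le e x : `|rat e (1 - (e ^+ 2)%:P * 'X^2) 2 x| <= 1.
Proof.
have d1 := den_ge1 e x; have d0 := den_gt0 e x.
rewrite /rat (_ : _.[x] = 1 - (e * x) ^+ 2); last first.
  by rewrite hornerD hornerN hornerCM hornerC hornerXn; ring.
rewrite normrM normfV (gtr0_norm (exprn_gt0 2 d0)) ler_pdivrMr ?exprn_gt0// mul1r.
apply: (@le_trans _ _ (den e).[x]); last by rewrite -[leLHS]expr1 ler_weXn2l.
have h := sqr_ge0 (e * x); rewrite denE ler_norml; apply/andP; split; lra.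
Qed.

(** With [u = e x] and [d = 1 + u^2], the numerator is [e u (2 u^2 - 6)], where [|u| <= d] and
    [|2 u^2 - 6| <= 6 d]; the quotient is thus at most [6 e d^2 / d^3]. *)
Lemma rat_id''_le e x : 0 <= e -> e <= 1 ->
  `|rat e ((2 * e ^+ 4)%:P * 'X^3 - (6 * e ^+ 2)%:P * 'X) 3 x| <= 6.
Proof.
move=> e0 e1; have d1 := den_ge1 e x; have d0 := den_gt0 e x.
rewrite /rat (_ : _.[x] = e * ((e * x) * (2 * (e * x) ^+ 2 - 6))); last first.
  by rewrite hornerD hornerN !hornerCM hornerXn hornerX; ring.
rewrite normrM normfV (gtr0_norm (exprn_gt0 3 d0)) ler_pdivrMr ?exprn_gt0//.
rewrite normrM (ger0_norm e0) (le_trans (ler_piMl _ e1))//.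
have u1 : `|e * x| <= (den e).[x].
  rewrite denE -(real_normK (num_real (e * x))) -subr_ge0.
  have := sqr_ge0 (`|e * x| - 1); have := normr_ge0 (e * x); lra.
have u2 : `|2 * (e * x) ^+ 2 - 6| <= 6 * (den e).[x].
  have h := sqr_ge0 (e * x); rewrite denE ler_norml; apply/andP; split; lra.
rewrite normrM (le_trans (ler_pM _ _ u1 u2))// mulrCA ler_wpM2l// -expr2.
by rewrite ler_weXn2l.
Qed.

(** Both factors are truncated, since the test function must be bounded in [xi] too. The primed
    versions are its first two derivatives in [x]. *)
Definition xxi_trunc e (z : R * R) := rat e 'X 1 z.1 * rat e 'X 1 z.2.
Definition xxi_trunc' e (z : R * R) :=
  rat e (1 - (e ^+ 2)%:P * 'X^2) 2 z.1 * rat e 'X 1 z.2.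
Definition xxi_trunc'' e (z : R * R) :=
  rat e ((2 * e ^+ 4)%:P * 'X^3 - (6 * e ^+ 2)%:P * 'X) 3 z.1 * rat e 'X 1 z.2.

Lemma x_xxi_trunc'_le e z : `|z.1 * xxi_trunc' e z| <= `|z.1 * z.2|.
Proof.
rewrite normrM [leRHS]normrM ler_wpM2l// normrM -[leRHS]mul1r.
by apply: ler_pM => //; [exact: rat_id'_le|exact: norm_rat_id_le].
Qed.

Lemma xi_xxi_trunc'_le e z : `|z.2 * xxi_trunc' e z| <= z.2 ^+ 2.
Proof.
rewrite -(real_normK (num_real z.2)) expr2 normrM ler_wpM2l// normrM.
rewrite -[leRHS]mul1r.
by apply: ler_pM => //; [exact: rat_id'_le|exact: norm_rat_id_le].
Qed.

Lemma xxi_trunc''_le e z : 0 <= e -> e <= 1 ->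
  `|xxi_trunc'' e z| <= 3 * 1 + 3 * z.2 ^+ 2.
Proof.
move=> e0 e1; rewrite normrM.
apply: le_trans (ler_pM _ _ (rat_id''_le z.1 e0 e1) (norm_rat_id_le _ _)) _ => //.
rewrite -(real_normK (num_real z.2)).
have := sqr_ge0 (`|z.2| - 1); lra.
Qed.

Lemma xxi_trunc_le e z : `|xxi_trunc e z| <= `|z.1 * z.2|.
Proof.
by rewrite normrM [leRHS]normrM; apply: ler_pM => //; exact: norm_rat_id_le.
Qed.

Lemma quadratic_growth_xxi_trunc e : quadratic_growth (xxi_trunc e).
Proof.
apply: (@quadratic_growth_separated _ _ _ 1); [exact: rat_continuous..|].
by move=> x y; exact: le_trans (xxi_trunc_le e (x, y)) (normM_le_quad x y).
Qed.

Lemma admissible_xxi e : 0 <= e -> e <= 1 ->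
  admissible (xxi_trunc' e) (xxi_trunc'' e).
Proof.
move=> e0 e1; split.
- apply: (@eq_quadratic_growth _ (fun z =>
    (z.1 * rat e (1 - (e ^+ 2)%:P * 'X^2) 2 z.1) * rat e 'X 1 z.2)) => [z|].
    by rewrite -mulrA.
  apply: (@quadratic_growth_separated _
    (fun x => x * rat e (1 - (e ^+ 2)%:P * 'X^2) 2 x) _ 1).
  + by move=> x; apply: cvgM; [exact: cvg_id|exact: rat_continuous].
  + exact: rat_continuous.
  + move=> x y; rewrite -mulrA.
    exact: le_trans (x_xxi_trunc'_le e (x, y)) (normM_le_quad x y).
- apply: (@eq_quadratic_growth _ (fun z =>
    rat e (1 - (e ^+ 2)%:P * 'X^2) 2 z.1 * (z.2 * rat e 'X 1 z.2))) => [z|].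
    by rewrite mulrCA.
  apply: (@quadratic_growth_separated _ _ (fun y => y * rat e 'X 1 y) 1).
  + exact: rat_continuous.
  + by move=> x; apply: cvgM; [exact: cvg_id|exact: rat_continuous].
  + move=> x y; rewrite mulrCA (le_trans (xi_xxi_trunc'_le e (x, y)))//=.
    by have := sqr_ge0 x; lra.
- apply: (@quadratic_growth_separated _ _ _ 3); [exact: rat_continuous..|].
  move=> x y; apply: le_trans (xxi_trunc''_le (x, y) e0 e1) _ => /=.
  by have := sqr_ge0 x; lra.
Qed.

(** Unlike in [rat_cvg] the numerator may vary with [n], as it does in the derivatives of the
    truncations. *)
Lemma rat_seq_cvg (p_ : nat -> {poly R}) b x (l : R) :
  (p_ n).[x] @[n --> \oo] --> l ->
  rat (eps n) (p_ n) b x @[n --> \oo] --> l.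
Proof.
move=> pl; suff : rat (eps n) (p_ n) b x @[n --> \oo] --> l / 1 ^+ b.
  by rewrite expr1n divr1.
apply: cvgM => //; apply: cvgV; first by rewrite expr1n oner_neq0.
by apply: (@cvg_comp _ _ _ _ (fun y : R => y ^+ b) _ _ _ _ (@exprn_continuous _ b _));
  exact: den_cvg.
Qed.

Lemma eps_exp_cvg k (c : R) : c * (eps n : R) ^+ k.+1 @[n --> \oo] --> (0 : R).
Proof.
suff : c * (eps n : R) ^+ k.+1 @[n --> \oo] --> c * 0 ^+ k.+1.
  by rewrite expr0n mulr0.
apply: cvgMr.
by apply: (@cvg_comp _ _ _ _ (fun y : R => y ^+ k.+1) _ _ _ _ (@exprn_continuous _ k.+1 _));
  exact: eps_cvg.
Qed.

Lemma rat_sqr'_cvg x : rat (eps n) (2%:P * 'X) 2 x @[n --> \oo] --> 2 * x.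
Proof. by have := @rat_cvg R (2%:P * 'X) 2 x; rewrite hornerM hornerC hornerX. Qed.

Lemma rat_sqr''_cvg x :
  rat (eps n) (2%:P - (6 * eps n ^+ 2)%:P * 'X^2) 3 x @[n --> \oo] --> (2 : R).
Proof.
apply: rat_seq_cvg.
under eq_fun do rewrite hornerD hornerN hornerCM hornerC hornerXn.
suff : 2 - 6 * eps n ^+ 2 * x ^+ 2 @[n --> \oo] --> 2 - 0 * x ^+ 2.
  by rewrite mul0r subr0.
apply: cvgB; first exact: cvg_cst.
by apply: cvgMl; exact: eps_exp_cvg.
Qed.

Lemma rat_id'_cvg x :
  rat (eps n) (1 - (eps n ^+ 2)%:P * 'X^2) 2 x @[n --> \oo] --> (1 : R).
Proof.
apply: rat_seq_cvg.
under eq_fun do rewrite hornerD hornerN hornerCM hornerC hornerXn.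
suff : 1 - (1 * eps n ^+ 2) * x ^+ 2 @[n --> \oo] --> 1 - 0 * x ^+ 2.
  by under eq_fun do rewrite mul1r; rewrite mul0r subr0.
apply: cvgB; first exact: cvg_cst.
by apply: cvgMl; exact: eps_exp_cvg.
Qed.

Lemma rat_id''_cvg x :
  rat (eps n) ((2 * eps n ^+ 4)%:P * 'X^3 - (6 * eps n ^+ 2)%:P * 'X) 3 x
    @[n --> \oo] --> (0 : R).
Proof.
apply: rat_seq_cvg.
under eq_fun do rewrite hornerD hornerN !hornerCM hornerXn hornerX.
suff : 2 * eps n ^+ 4 * x ^+ 3 - 6 * eps n ^+ 2 * x @[n --> \oo] -->
    0 * x ^+ 3 - 0 * x by rewrite !mul0r subr0.
by apply: cvgB; apply: cvgMl; exact: eps_exp_cvg.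
Qed.

Lemma rat_id_cvg x : rat (eps n) 'X 1 x @[n --> \oo] --> x.
Proof. by have := @rat_cvg R 'X 1 x; rewrite hornerX. Qed.

End cross_moment_test_function.

(** * Equations for the moments *)

Section moment_equations.
Context {R : realType}.
Variables (omega tau : R) (mu : skorokhod R).
Implicit Types (s t : R) (f g : R * R -> R).
Hypothesis homega : 0 < omega.
Hypothesis htau : 0 < tau.
Hypothesis hmu : weak_solution omega tau mu.
Hypothesis hxi : forall t, 0 <= t -> (\int[mu t]_z (z.2 ^+ 2)%:E = 1)%E.

Let E s g := \int[mu s]_z g z.
Let lam s := lambda_of (mu s).
Let Q s := cosine_of (mu s).

Lemma E_dominated_cvg s (g_ : nat -> R * R -> R) g (a : R) : 0 <= s ->
  (forall n, quadratic_growth (g_ n)) ->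
  (forall n z, `|g_ n z| <= a * quad z) ->
  (forall z, g_ n z @[n --> \oo] --> g z) ->
  E s (g_ n) @[n --> \oo] --> E s g.
Proof.
move=> s0 qg ga gg; apply: (@Rintegral_dominated_cvg _ _ _ (mu s) setT g_ g
  (fun z => a * quad z)) => //.
- by move=> n; have [] := qg n.
- exact: eq_integrable (integrableZl measurableT a
    (quad_integrable (integrable_x2 hmu s0) (integrable_xi2 hxi s0))).
Qed.

(** Dominated convergence twice: in [z] at each fixed time, with majorant [a * quad], then in time
    on [[0, t]], with a constant majorant because [B] does not depend on [n]. *)
Lemma limit_equation (f_ g1_ g2_ : nat -> R * R -> R) f g1 g2 (a B t : R) :
  0 <= t ->
  (forall n, E t (f_ n) - E 0 (f_ n) =
    \int[lebesgue_measure]_(s in `[0, t]) rate omega tau mu (g1_ n) (g2_ n) s) ->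
  (forall n, quadratic_growth (f_ n)) -> (forall n z, `|f_ n z| <= a * quad z) ->
  (forall z, f_ n z @[n --> \oo] --> f z) ->
  (forall n, admissible (g1_ n) (g2_ n)) ->
  (forall n z, `|z.1 * g1_ n z| <= a * quad z) ->
  (forall n z, `|z.2 * g1_ n z| <= a * quad z) ->
  (forall n z, `|g2_ n z| <= a * quad z) ->
  (forall z, g1_ n z @[n --> \oo] --> g1 z) ->
  (forall z, g2_ n z @[n --> \oo] --> g2 z) ->
  (forall n s, 0 <= s <= t -> moment_bounds mu (g1_ n) (g2_ n) B s) ->
  E t f - E 0 f = \int[lebesgue_measure]_(s in `[0, t]) rate omega tau mu g1 g2 s.
Proof.
move=> t0 eqn qf fa ff ad a1 a2 a3 c1 c2 mb.
have lhs : E t (f_ n) - E 0 (f_ n) @[n --> \oo] --> E t f - E 0 f.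
  by apply: cvgB; exact: E_dominated_cvg qf fa ff.
have rate_cvg s : 0 <= s ->
    rate omega tau mu (g1_ n) (g2_ n) s @[n --> \oo] --> rate omega tau mu g1 g2 s.
  move=> s0.
  have e1 : E s (fun z => z.1 * g1_ n z) @[n --> \oo] --> E s (fun z => z.1 * g1 z).
    apply: (E_dominated_cvg s0 _ a1) => [n|z]; first by have [] := ad n.
    by apply: cvgMr; exact: c1.
  have e2 : E s (fun z => z.2 * g1_ n z) @[n --> \oo] --> E s (fun z => z.2 * g1 z).
    apply: (E_dominated_cvg s0 _ a2) => [n|z]; first by have [] := ad n.
    by apply: cvgMr; exact: c1.
  have e3 : E s (g2_ n) @[n --> \oo] --> E s g2.
    by apply: (E_dominated_cvg s0 _ a3 c2) => n; have [] := ad n.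
  apply: cvgD; last by apply: cvgMr; apply: cvgMr.
  apply: cvgMr; apply: cvgB => //; apply: cvgD; first exact: cvgMr.
  exact: cvgMl.
have rhs : \int[lebesgue_measure]_(s in `[0, t]) rate omega tau mu (g1_ n) (g2_ n) s
    @[n --> \oo] --> \int[lebesgue_measure]_(s in `[0, t]) rate omega tau mu g1 g2 s.
  pose K := (tau * (omega + 2) + tau ^+ 2 * (omega + 1)) * B.
  apply: (@Rintegral_dominated_cvg _ _ _ _ _ _ _ (fun=> K)).
  - exact: measurable_itv.
  - by move=> n; apply: measurable_itv_time; exact: (measurable_rate hmu hxi (ad n)).
  - by move=> s /=; rewrite in_itv/= => /andP[s0 _]; exact: rate_cvg.
  - exact: (@bounded_itv_integrable _ _ _ _ `|K|).
  - move=> n s /=; rewrite in_itv/= => /[dup] st /andP[s0 _].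
    exact: (norm_rate_le homega htau hmu hxi s0 (ad n) (mb n s st)).
rewrite (funext eqn) in lhs; exact: cvg_unique lhs rhs.
Qed.

Lemma lam_bounded t : 0 <= t ->
  exists2 K : R, 0 <= K & forall s, 0 <= s <= t -> lam s <= K.
Proof.
move=> t0; have [K hK] := second_moment_bounded homega htau hmu hxi t0.
have K0 : 0 <= K by apply: le_trans (hK 0 _); rewrite ?sqr_ge0 ?lexx.
exists (K + 1) => [|s st]; first by rewrite addr_ge0.
have := hK s st; rewrite -/(lam s) => h.
rewrite leNgt; apply/negP => Kl; have : K < lam s ^+ 2 by nra.
by rewrite ltNge h.
Qed.

(** This is [rate] for [g1 = 2 x], [g2 = 2], and [xxi_rate] is [rate] for [g1 = xi], [g2 = 0], after
    substituting [E(x xi) = Q lam], [E(x^2) = lam^2] and [E(xi^2) = 1]. *)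
Definition sqr_rate s : R := 2 * tau * (omega * Q s ^+ 2 * lam s + lam s - lam s ^+ 2) +
  diffusionJ omega tau (Q s).

Definition xxi_rate s : R := tau * (omega * Q s + Q s - Q s * lam s).

Lemma second_moment_equation t : 0 <= t ->
  lam t ^+ 2 - lam 0 ^+ 2 = \int[lebesgue_measure]_(s in `[0, t]) sqr_rate s.
Proof.
move=> t0; have [K K0 hK] := lam_bounded t0.
rewrite !(sqr_lam mu).
(* In the last constant, [2 K] bounds the [xi] term [2 lam] and [2 K^2] the [x] term
   [2 U <= 2 lam^2], which is also at most [2 K lam]; [6] bounds the second derivative. *)
rewrite (@limit_equation (fun n z => rat (eps n) 'X^2 1 z.1)
  (fun n z => rat (eps n) (2%:P * 'X) 2 z.1)
  (fun n z => rat (eps n) (2%:P - (6 * eps n ^+ 2)%:P * 'X^2) 3 z.1)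
  _ (fun z => 2 * z.1) (fun=> 2) 6 (2 * K + 2 * K ^+ 2 + 6)) //.
- apply: eq_Rintegral => s; rewrite inE/= in_itv/= => /andP[s0 _].
  rewrite /rate /drift_rate /diffusion_rate /sqr_rate Rintegral_prob_cst.
  rewrite (_ : (fun z : R * R => z.2 * (2 * z.1)) =
    fun z => 2 * (z.1 * z.2) + 0 * (z.1 * z.2)); last first.
    by apply/funext => z; ring.
  rewrite (_ : (fun z : R * R => z.1 * (2 * z.1)) =
    fun z => 2 * z.1 ^+ 2 + 0 * z.1 ^+ 2); last first.
    by apply/funext => z; ring.
  rewrite !(E_linear2 hmu hxi) //; try exact: quadratic_growth_xxi;
    try exact: quadratic_growth_x2.
  rewrite -(sqr_lam mu) -(Q_lamE hmu s0) -/(Q s) -/(lam s).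
  by field; rewrite gt_eqF// (lam_gt0 hmu s0).
- by move=> n; exact: truncated_equation.
- by move=> n; exact: quadratic_growth_rat_sqr.
- move=> n z; rewrite ger0_norm ?rat_sqr_ge0// (le_trans (rat_sqr_le _ _))//.
  rewrite /quad; have := sqr_ge0 z.1; have := sqr_ge0 z.2; lra.
- move=> z; have <- : 'X^2.[z.1 : R] = z.1 ^+ 2 by rewrite hornerXn.
  exact: rat_cvg.
- by move=> n; exact: admissible_sqr.
- move=> n z; have /andP[h0 h1] := x_rat_sqr' (eps n) z.1; rewrite ger0_norm//.
  have := rat_sqr_le (eps n) z.1; rewrite /quad.
  have := sqr_ge0 z.1; have := sqr_ge0 z.2; lra.
- move=> n z; rewrite (le_trans (xi_rat_sqr'_le _ _ _))//.
  have := normM_le_quad z.1 z.2; rewrite -/(quad z); have := quad_ge1 z; lra.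
- move=> n z; rewrite (le_trans (rat_sqr''_le _ _))//.
  have := quad_ge1 z; lra.
- by move=> z; exact: rat_sqr'_cvg.
- by move=> z; exact: rat_sqr''_cvg.
- move=> n s /[dup] st /andP[s0 _]; have [q1 q2 q3] := admissible_sqr (eps n : R).
  have l0 : 0 < lam s := lam_gt0 hmu s0; have lK := hK s st.
  have [U0 U1 U2] := truncated_sqr_bounds hmu hxi n s0.
  have hx := E_x_sqr'_le hmu hxi n s0.
  rewrite -/(lam s) in U2.
  have h1 : lam s ^+ 2 <= K * lam s by rewrite expr2 ler_wpM2r// ltW.
  have h2 : lam s ^+ 2 <= K ^+ 2 by rewrite lerXn2r ?nnegrE// ltW.
  have K2 := sqr_ge0 K.
  have hxi2 : \int[mu s]_z `|z.2 * rat (eps n) (2%:P * 'X) 2 z.1| <= 2 * lam s.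
    apply: (E_norm_xxi_le hmu hxi s0 q2) => // z; exact: xi_rat_sqr'_le.
  have h6 := E_sqr''_le hmu hxi n s0.
  split.
  + by apply: le_trans hxi2 _; lra.
  + by apply: le_trans hx _; lra.
  + apply: le_trans hx _; rewrite -/(lam s).
    have : 0 <= (2 * K ^+ 2 + 6) * lam s by rewrite mulr_ge0 ?addr_ge0 ?mulr_ge0// ltW.
    lra.
  + by apply: le_trans h6 _; lra.
Qed.

Lemma cross_moment_equation t : 0 <= t ->
  Q t * lam t - Q 0 * lam 0 = \int[lebesgue_measure]_(s in `[0, t]) xxi_rate s.
Proof.
move=> t0; have [K K0 hK] := lam_bounded t0.
have e0 n : 0 <= (eps n : R) by exact/ltW/eps_gt0.
have e1 n := @eps_le1 R n.
(* The [x] term is at most [lam <= K] by Cauchy-Schwarz, the [xi] term at most [<xi^2> = 1], and the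
   second derivative at most [3 + 3 xi^2], of integral [6]. *)
have mb n s : 0 <= s <= t ->
    moment_bounds mu (xxi_trunc' (eps n)) (xxi_trunc'' (eps n)) (K + 6) s.
  move=> /[dup] st /andP[s0 _]; have [q1 q2 q3] := admissible_xxi (e0 n) (e1 n).
  have l0 : 0 < lam s := lam_gt0 hmu s0; have lK := hK s st.
  have hx : \int[mu s]_z `|z.1 * xxi_trunc' (eps n) z| <= 1 * lam s.
    by apply: (E_norm_xxi_le hmu hxi s0 q1) => // z; rewrite mul1r x_xxi_trunc'_le.
  have hy : \int[mu s]_z `|z.2 * xxi_trunc' (eps n) z| <= 1.
    rewrite -(second_moment_xi1 hxi s0).
    apply: (E_normed_le hmu hxi s0 q2); first exact: quadratic_growth_xi2.
    by move=> z; exact: xi_xxi_trunc'_le.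
  have hz : \int[mu s]_z `|xxi_trunc'' (eps n) z| <= 6.
    have qc : quadratic_growth (fun _ : R * R => 1 : R).
      split; [by move=> ?; exact: cvg_cst|exact: measurable_cst|exists 1 => z].
      by rewrite normr1 mul1r quad_ge1.
    apply: le_trans (E_normed_le hmu hxi s0 q3 (quadratic_growth_lin2 3 3 qc
      (@quadratic_growth_xi2 R)) _) _.
      by move=> z; exact: xxi_trunc''_le.
    rewrite (E_linear2 hmu hxi _ _ s0 qc (@quadratic_growth_xi2 R)).
    rewrite (second_moment_xi1 hxi s0) Rintegral_prob_cst; lra.
  split.
  - by apply: le_trans hy _; lra.
  - by apply: le_trans hx _; lra.
  - apply: le_trans hx _; rewrite -/(lam s).
    by rewrite ler_wpM2r ?(ltW l0)//; lra.
  - by apply: le_trans hz _; lra.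
rewrite (Q_lamE hmu t0) (Q_lamE hmu (lexx 0)).
rewrite (@limit_equation (fun n => xxi_trunc (eps n)) (fun n => xxi_trunc' (eps n))
  (fun n => xxi_trunc'' (eps n)) _ (fun z => z.2) (fun=> 0) 6 (K + 6)) //.
- apply: eq_Rintegral => s; rewrite inE/= in_itv/= => /andP[s0 _].
  rewrite /rate /drift_rate /diffusion_rate /xxi_rate Rintegral_prob_cst.
  rewrite (_ : (fun z : R * R => z.2 * z.2) = fun z => z.2 ^+ 2)//.
  rewrite (second_moment_xi1 hxi s0) -(Q_lamE hmu s0) -/(Q s) -/(lam s).
  by field; rewrite gt_eqF// (lam_gt0 hmu s0).
- move=> n.
  have en := @eps_gt0 R n.
  (* Each factor of [xxi_trunc] is at most [1 / (2 e)] in absolute value, so the product stays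
     within [e^-2 / 4] and the added [e^-2] makes the test function positive. *)
  have fE : (fun z => eps n ^- 2 + xxi_trunc (eps n) z) =
      rat2 (eps n) (eps n ^- 2) 'X 1 'X 1 by [].
  have hb (z : R * R) : `|xxi_trunc (eps n) z| <= eps n ^- 2 / 4.
    rewrite normrM (_ : _ / 4 = (2 * eps n)^-1 * (2 * eps n)^-1); last first.
      by rewrite -invfM -invfM; congr _^-1; ring.
    by apply: ler_pM => //; exact: (rat_id_le _ en).
  have e2 : 0 < (eps n : R) ^- 2 by rewrite invr_gt0 exprn_gt0.
  apply: (@weak_equation_shift _ omega tau mu homega htau hmu hxi (eps n ^- 2)
    _ _ _ (K + 6)).
  + exact: quadratic_growth_xxi_trunc.
  + move=> z; have := hb z; rewrite ler_norml => /andP[h1 h2]; lra.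
  + exists (eps n ^- 2 + eps n ^- 2 / 4) => z.
    by have := hb z; rewrite ler_norml => /andP[h1 h2]; lra.
  + by rewrite fE; exact: class_C_rat2.
  + rewrite fE d_x_rat2 rat_deriv_id; apply/funext => z.
    by rewrite /rat2 add0r.
  + rewrite (_ : xxi_trunc' _ = rat2 (eps n) 0 (1 - (eps n ^+ 2)%:P * 'X^2) 2 'X 1).
      rewrite d_x_rat2 rat_deriv_id2; apply/funext => z.
      by rewrite /rat2 add0r.
    by apply/funext => z; rewrite /rat2 add0r.
  + exact: admissible_xxi.
  + exact: mb.
  + exact: t0.
- by move=> n; exact: quadratic_growth_xxi_trunc.
- move=> n z; rewrite (le_trans (xxi_trunc_le _ _))//.
  have := normM_le_quad z.1 z.2; rewrite -/(quad z); have := quad_ge1 z; lra.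
- by move=> z; apply: cvgM; exact: rat_id_cvg.
- by move=> n; exact: admissible_xxi.
- move=> n z; rewrite (le_trans (x_xxi_trunc'_le _ _))//.
  have := normM_le_quad z.1 z.2; rewrite -/(quad z); have := quad_ge1 z; lra.
- move=> n z; rewrite (le_trans (xi_xxi_trunc'_le _ _))// /quad.
  have := sqr_ge0 z.1; have := sqr_ge0 z.2; lra.
- move=> n z; rewrite (le_trans (xxi_trunc''_le _ _ _))// /quad.
  have := sqr_ge0 z.1; have := sqr_ge0 z.2; lra.
- move=> z; rewrite -[X in _ --> X]mul1r.
  by apply: cvgM; [exact: rat_id'_cvg|exact: rat_id_cvg].
- move=> z; rewrite -[X in _ --> X](mul0r z.2).
  by apply: cvgM; [exact: rat_id''_cvg|exact: rat_id_cvg].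
Qed.

End moment_equations.

(** * The differential equation *)

(* Integral equations hold for nonnegative times only; reflecting the integrand
   at 0 makes its primitive differentiable on both sides of 0. *)
Section reflected_primitive.
Context {R : realType}.
Variables (u h : R -> R).
Hypothesis mh : measurable_fun (`[0, +oo[%classic : set R) h.
Hypothesis bh : forall t, 0 <= t ->
  exists B : R, forall s, 0 <= s <= t -> `|h s| <= B.
Hypothesis uh : forall t, 0 <= t ->
  u t - u 0 = \int[lebesgue_measure]_(s in `[0, t]) h s.

Let hr (s : R) := h `|s|.

(** Starting the integral at [-1] makes [0] an interior point; the part below [0] is subtracted so
    that the values at nonnegative times are those of [u]. *)
Definition primitive (t : R) : R := u 0 +
  (\int[lebesgue_measure]_(s in `[-1, t]) hr s -
   \int[lebesgue_measure]_(s in `[-1, 0]) hr s).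

Lemma reflected_integrable (t : R) :
  lebesgue_measure.-integrable `[-1, t] (EFin \o hr).
Proof.
have t1 : 0 <= `|t| + 1 by rewrite addr_ge0.
have [B hB] := bh t1; apply: (@bounded_itv_integrable _ _ _ _ B).
  have mn : measurable_fun `[-1, t] (fun s : R => `|s|) by exact: measurableT_comp.
  have ran : [set `|s| | s in `[-1, t]] `<=` (`[0, +oo[%classic : set R).
    by move=> _ [s _ <-]; rewrite /= in_itv/= andbT.
  exact: (measurable_comp _ ran mh mn).
move=> s /andP[s1 st]; apply: hB; rewrite normr_ge0/= ler_norml.
have := ler_norm t; have := normr_ge0 t; move=> ? ?; apply/andP; split; lra.
Qed.

Lemma primitiveE (t : R) : 0 <= t -> primitive t = u t.
Proof.
move=> t0; have a1 : (BLeft (-1) <= BRight (0 : R))%O by rewrite bnd_simp lerN10.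
have a2 : (BRight 0 <= BRight t)%O by rewrite bnd_simp.
rewrite /primitive (Rintegral_itvB (reflected_integrable t) a1 a2).
rewrite Rintegral_itv_obnd_cbnd; last first.
  apply: integrableS (reflected_integrable t) => //.
  by apply: subset_itvr; rewrite bnd_simp lerN10.
have -> : \int[lebesgue_measure]_(s in `[0, t]) hr s =
    \int[lebesgue_measure]_(s in `[0, t]) h s.
  apply: eq_Rintegral => s; rewrite inE/= in_itv/= => /andP[s0 _].
  by rewrite /hr ger0_norm.
by rewrite -uh// addrC subrK.
Qed.

Lemma primitive_continuous (t : R) : 0 <= t -> {for t, continuous primitive}.
Proof.
move=> t0; have h1 : -1 <= t + 1 by lra.
have := parameterized_integral_continuous h1 (reflected_integrable (t + 1)).
move=> /(within_continuous_continuous (x := t)) ct.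
apply: cvgD; first exact: cvg_cst.
apply: cvgB; last exact: cvg_cst.
by apply: ct; rewrite ?in_itv/=; lra.
Qed.

(** A primitive of a locally bounded measurable function is continuous, so nothing is asked of the
    regularity of [h]. This breaks a circle: in the application [h] is a function of [lam] and [Q],
    whose continuity is at stake. *)
Lemma reflected_continuous : continuous (fun t : R => u `|t|).
Proof.
move=> t.
rewrite (_ : (fun t => _) = primitive \o (fun t : R => `|t|)); last first.
  by apply/funext => s /=; rewrite primitiveE.
apply: continuous_comp; first exact: (@norm_continuous R R^o t).
exact: primitive_continuous.
Qed.

Lemma is_derive_primitive (t : R) : 0 <= t -> continuous hr ->
  is_derive t (1 : R) primitive (h t).
Proof.
move=> t0 ch.
have tt1 : t < t + 1 by rewrite ltrDl.
have h1 : ((-1)%:E < t%:E)%E by rewrite lte_fin (lt_le_trans _ t0)// ltrN10.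
have := continuous_FTC1 tt1 (reflected_integrable (t + 1)).
move=> /= /(_ h1 (ch t)) [dF dFE].
have dF' : is_derive t (1 : R)
    (fun x => \int[lebesgue_measure]_(s in `[-1, x]) hr s) (h t).
  by split; [exact: dF|rewrite -derive1E dFE /hr ger0_norm].
pose c := \int[lebesgue_measure]_(s in `[-1, 0]) hr s.
have := is_deriveD (is_derive_cst (u 0) t (1 : R))
  (is_deriveB dF' (is_derive_cst c t (1 : R))).
by rewrite subr0 add0r.
Qed.

End reflected_primitive.

(** * Differentiability of the cosine *)

Section cosine_ode.
Context {R : realType}.
Variables (omega tau : R) (mu : skorokhod R).
Implicit Types (s t : R).
Hypothesis homega : 0 < omega.
Hypothesis htau : 0 < tau.
Hypothesis hmu : weak_solution omega tau mu.
Hypothesis hxi : forall t, 0 <= t -> (\int[mu t]_z (z.2 ^+ 2)%:E = 1)%E.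

Let lam s := lambda_of (mu s).
Let Q s := cosine_of (mu s).
Let dL := sqr_rate omega tau mu.
Let dV := xxi_rate omega tau mu.
Let L s := lam s ^+ 2.
Let V s := Q s * lam s.
Let time : set R := `[0, +oo[%classic.

Lemma measurable_sqr_rate : measurable_fun time dL.
Proof.
have mQ : measurable_fun time Q := measurable_Q hmu hxi.
have ml : measurable_fun time lam := measurable_lam hmu hxi.
have mQ2 : measurable_fun time (fun s => Q s ^+ 2) by exact: measurable_funX.
apply: measurable_funD.
  apply: measurable_funM => //; apply: measurable_funB; last exact: measurable_funX.
  apply: measurable_funD => //; apply: measurable_funM => //.
  exact: measurable_funM.
apply: measurable_funM => //; apply: measurable_funD => //.
exact: measurable_funM.
Qed.

Lemma measurable_xxi_rate : measurable_fun time dV.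
Proof.
have mQ : measurable_fun time Q := measurable_Q hmu hxi.
have ml : measurable_fun time lam := measurable_lam hmu hxi.
apply: measurable_funM => //; apply: measurable_funB; last exact: measurable_funM.
by apply: measurable_funD => //; exact: measurable_funM.
Qed.

Lemma sqr_rate_bounded t : 0 <= t ->
  exists B : R, forall s, 0 <= s <= t -> `|dL s| <= B.
Proof.
move=> t0; have [K K0 hK] := lam_bounded homega htau hmu hxi t0.
exists (2 * tau * (omega * K + K + K ^+ 2) + tau ^+ 2 * (omega + 1)).
move=> s /[dup] st /andP[s0 _].
have l0 : 0 < lam s := lam_gt0 hmu s0; have lK : lam s <= K := hK s st.
have Q1 : `|Q s| <= 1 := norm_Q_le1 hmu hxi s0.
have Q2 : `|Q s ^+ 2| <= 1 by rewrite normrX exprn_ile1.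
have /andP[J0 J1] := diffusionJ_bound homega hmu hxi s0.
have t2 : 0 < 2 * tau by rewrite mulr_gt0.
rewrite (le_trans (ler_normD _ _))// lerD//; last by rewrite ger0_norm.
rewrite normrM (gtr0_norm t2) ler_pM2l// (le_trans (ler_normB _ _))// lerD//.
  rewrite (le_trans (ler_normD _ _))// lerD//; last by rewrite gtr0_norm.
  rewrite -mulrA normrM (gtr0_norm homega) ler_pM2l// normrM -[leRHS]mul1r.
  by apply: ler_pM => //; rewrite gtr0_norm.
by rewrite normrX lerXn2r ?nnegrE// gtr0_norm.
Qed.

Lemma xxi_rate_bounded t : 0 <= t ->
  exists B : R, forall s, 0 <= s <= t -> `|dV s| <= B.
Proof.
move=> t0; have [K K0 hK] := lam_bounded homega htau hmu hxi t0.
exists (tau * (omega + 1 + K)) => s /[dup] st /andP[s0 _].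
have l0 : 0 < lam s := lam_gt0 hmu s0; have lK : lam s <= K := hK s st.
have Q1 : `|Q s| <= 1 := norm_Q_le1 hmu hxi s0.
rewrite normrM (gtr0_norm htau) ler_pM2l// (le_trans (ler_normB _ _))// lerD//.
  rewrite (le_trans (ler_normD _ _))// lerD//.
  by rewrite normrM (gtr0_norm homega) ler_piMr// ltW.
rewrite normrM -[leRHS]mul1r.
by apply: ler_pM => //; rewrite gtr0_norm.
Qed.

Let eqL := @second_moment_equation R omega tau mu homega htau hmu hxi.
Let eqV := @cross_moment_equation R omega tau mu homega htau hmu hxi.

Lemma lam_continuous : continuous (fun t : R => lam `|t|).
Proof.
have cL := reflected_continuous measurable_sqr_rate sqr_rate_bounded eqL.
rewrite (_ : (fun _ => _) = Num.sqrt \o (fun t : R => L `|t|)); last first.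
  apply/funext => t /=; rewrite sqrtr_sqr.
  by rewrite (gtr0_norm (lam_gt0 hmu (normr_ge0 t))).
by move=> t; apply: continuous_comp; [exact: cL|exact: sqrt_continuous].
Qed.

Lemma Q_continuous : continuous (fun t : R => Q `|t|).
Proof.
have cV := reflected_continuous measurable_xxi_rate xxi_rate_bounded eqV.
have lne t : lam `|t| != 0 by rewrite gt_eqF// (lam_gt0 hmu (normr_ge0 t)).
rewrite (_ : (fun _ => _) = fun t : R => V `|t| / lam `|t|); last first.
  by apply/funext => t; rewrite /V mulfK.
by move=> t; apply: cvgM; [exact: cV|apply: cvgV => //; exact: lam_continuous].
Qed.

Lemma sqr_rate_continuous : continuous (fun t : R => dL `|t|).
Proof.
move=> t; have cl := lam_continuous (x := t); have cQ := Q_continuous (x := t).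
have cX k (f : R -> R) (l : R) : f s @[s --> t] --> l ->
    f s ^+ k @[s --> t] --> l ^+ k.
  by move=> fl; apply: (@cvg_comp _ _ _ f (fun y : R => y ^+ k) _ _ _ fl
    (@exprn_continuous _ k l)).
apply: cvgD.
  apply: cvgMr; apply: cvgB; last exact: (cX 2 _ _ cl).
  apply: cvgD; last exact: cl.
  by apply: cvgM; [apply: cvgMr; exact: (cX 2 _ _ cQ)|exact: cl].
apply: cvgMr; apply: cvgD; last exact: cvg_cst.
by apply: cvgMr; exact: (cX 2 _ _ cQ).
Qed.

Lemma xxi_rate_continuous : continuous (fun t : R => dV `|t|).
Proof.
move=> t; have cl := lam_continuous (x := t); have cQ := Q_continuous (x := t).
apply: cvgMr; apply: cvgB; last by apply: cvgM; [exact: cQ|exact: cl].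
by apply: cvgD; [apply: cvgMr|]; exact: cQ.
Qed.

Let Lp := primitive L dL.
Let Vp := primitive V dV.

(** It coincides with [Q] at nonnegative times and is defined on both sides of [0], so that the
    one-sided derivative at [0] is inherited from an ordinary one. *)
Definition extended_cosine t : R := Vp t / Num.sqrt (Lp t).

Lemma extended_cosineE t : 0 <= t -> extended_cosine t = Q t.
Proof.
move=> t0; have l0 : 0 < lam t := lam_gt0 hmu t0.
rewrite /extended_cosine /Lp /Vp.
rewrite (primitiveE measurable_sqr_rate sqr_rate_bounded eqL)//.
rewrite (primitiveE measurable_xxi_rate xxi_rate_bounded eqV)//.
by rewrite /L sqrtr_sqr (gtr0_norm l0) /V mulfK// gt_eqF.
Qed.

(** The derivative is [V' / lam - V L' / (2 lam^3)]. The contributions of [x / lambda] and [- x] to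
    the drift act on the norm and on the cross moment in the same proportion and cancel, leaving the
    signal terms in [omega] and the diffusion term. *)
Lemma is_derive_extended_cosine t : 0 <= t ->
  is_derive t (1 : R) extended_cosine (tau * Q t / lam t *
    (omega - omega * Q t ^+ 2 - tau * (omega * Q t ^+ 2 + 1) / (2 * lam t))).
Proof.
move=> t0; have l0 : 0 < lam t := lam_gt0 hmu t0.
have LE : Lp t = lam t ^+ 2.
  exact: (primitiveE measurable_sqr_rate sqr_rate_bounded eqL t0).
have VE : Vp t = Q t * lam t.
  exact: (primitiveE measurable_xxi_rate xxi_rate_bounded eqV t0).
have dLp : is_derive t (1 : R) Lp (dL t).
  exact: (is_derive_primitive L measurable_sqr_rate sqr_rate_bounded t0 sqr_rate_continuous).
have dVp : is_derive t (1 : R) Vp (dV t).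
  exact: (is_derive_primitive V measurable_xxi_rate xxi_rate_bounded t0 xxi_rate_continuous).
have sE : Num.sqrt (Lp t) = lam t by rewrite LE sqrtr_sqr gtr0_norm.
have L0 : 0 < Lp t by rewrite LE exprn_gt0.
have ds := is_derive1_comp (is_derive1_sqrt L0) dLp.
have sn : (Num.sqrt \o Lp) t != 0 by rewrite /= sE gt_eqF.
have := is_deriveM dVp (is_deriveV sn ds).
move=> /is_derive_eq; apply.
rewrite /GRing.scale/= sE VE /dL /dV /sqr_rate /xxi_rate /diffusionJ.
by rewrite -/(Q t) -/(lam t); field; rewrite gt_eqF.
Qed.

Lemma weak_solution_cosine_ode : cosine_ode omega tau mu.
Proof.
split => [t t0|].
  apply: near_eq_is_derive (is_derive_extended_cosine (ltW t0)).
  near=> s; apply: extended_cosineE; apply: ltW; near: s.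
  exact: lt_nbhsr.
have [df dfE] := is_derive_extended_cosine (lexx 0).
have : (fun h => h^-1 *: ((extended_cosine \o shift 0) (h *: (1 : R)) -
    extended_cosine 0)) @ 0^' --> 'D_1 extended_cosine 0 by exact: df.
(* The two-sided limit of the difference quotient is restricted to positive [h], where the extension
   agrees with [Q]. *)
rewrite dfE => /cvg_dnbhs_at_right.
apply: cvg_trans; apply: near_eq_cvg; near=> h.
have h0 : 0 <= h by apply: ltW; near: h; exact: nbhs_right_gt.
by rewrite /= /GRing.scale/= mulr1 addr0 !extended_cosineE.
Unshelve. all: by end_near. Qed.

End cosine_ode.

Theorem corollary1 (R : realType) (omega tau : R)
  (homega : 0 < omega) (htau : 0 < tau)
  (d : nat -> measure_display) (Omega : forall n : nat, measurableType (d n))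
  (P : forall n : nat, probability (Omega n) R)
  (xi : forall n : nat, 'cV[R]_n.+1)
  (hxi : forall n : nat, enorm (xi n) = Num.sqrt n.+1%:R)
  (x0 : forall n : nat, {RV (P n) >-> n.+1.-tuple R})
  (c : forall n : nat, nat -> {RV (P n) >-> R})
  (a : forall n : nat, nat -> {RV (P n) >-> n.+1.-tuple R})
  (hinputs : forall n : nat, spiked_inputs (x0 n) (c n) (a n))
  (hexch : forall n : nat, exchangeable (P n) (x0 n))
  (hmoment : exists C : R, forall n : nat, {ae P n, forall w,
     (\int[empirical_at omega tau (xi n) (x0 n) (c n) (a n) 0 w]_z
        (z.1 ^+ 4 + z.2 ^+ 4)%:E <= C%:E)%E})
  (htheta : exists l u : R, 0 < l /\ forall n : nat, {ae P n, forall w,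
     l <= rms (iterate omega tau (xi n) (x0 n) (c n) (a n) 0 w) <= u})
  (mu : skorokhod R)
  (hinit : cvg_in_law_to_cst (weakly_cvg \oo) P
     (fun n : nat => empirical_at omega tau (xi n) (x0 n) (c n) (a n) 0) (mu 0))
  (hQ0 : cosine_of (mu 0) != 0)
  (hlimit : cvg_in_law_to_cst (@skorokhod_cvg R) P
     (fun n : nat => empirical_process omega tau (xi n) (x0 n) (c n) (a n)) mu)
  (hpde : unique_weak_solution omega tau mu) :
  cosine_ode omega tau mu.
Proof.
have [hmu _] := hpde; have [C hC] := hmoment.
have m0 : (\int[mu 0%R]_z (z.2 ^+ 2)%:E = 1)%E.
  exact: (initial_second_moment (x0 := fun n w => vec (x0 n w)) hxi hC hinit).
apply: weak_solution_cosine_ode => // t t0.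
by rewrite (weak_solution_second_moment_xi hmu t0).
Qed.
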